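(* Let $(\xi_{ij})_{i,j\ge 1}$ be i.i.d. real random variables, distributed as a random variable $\xi$ with $\mathbf{E}[\xi]=0$, $\mathbf{E}[\xi^2]=1$ and $\mathbf{E}[|\xi|^3]<+\infty$. Let $\beta>0$ and $h\in\mathbb{R}$. Then, as $N\to\infty$, $$\frac1N \log Z_N(\beta,\xi)\to\alpha_\infty(\beta)\quad\text{almost surely and in average (i.e. } \tfrac1N\mathbf{E}[\log Z_N(\beta,\xi)]\to\alpha_\infty(\beta)\text{)}.$$ Furthermore, the averages $\alpha_N(\beta,\xi):=\frac1N\mathbf{E}[\log Z_N(\beta,\xi)]$ satisfy, for every $N\ge1$, $$|\alpha_N(\beta,\xi)-\alpha_N(\beta,g)|\le 9\,\mathbf{E}[|\xi|^3]\,\frac{\beta^3}{\sqrt N}.$$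
   Context: For $N\ge 1$, $\sigma=(\sigma_1,\dots,\sigma_N)\in\{-1,1\}^N$ and a real array $\xi=(\xi_{ij})$, set $H_N(\sigma,\xi)=\sum_{1\le i,j\le N}\xi_{ij}\sigma_i\sigma_j$. The partition function is $$Z_N(\beta,\xi)=2^{-N}\sum_{\sigma\in\{-1,1\}^N}\exp\Big(\frac{\beta}{\sqrt N}H_N(\sigma,\xi)+h\sum_{i=1}^N\sigma_i\Big),$$ where $h\in\mathbb{R}$ is a fixed parameter (suppressed from the notation). $\mathbf{E}$ denotes expectation with respect to the environment. $g=(g_{ij})_{i,j\ge1}$ denotes an environment of i.i.d. standard Gaussian $\mathcal N(0,1)$ variables, and $\alpha_N(\beta,g)=\frac1N\mathbf{E}[\log Z_N(\beta,g)]$. The number $\alpha_\infty(\beta)$ (which depends also on $h$) is the deterministic limit of $\frac1N\log Z_N(\beta,g)$, almost surely and in average, as $N\to\infty$; the existence of this limit for the Gaussian environment is a known theorem of Guerra and Toninelli. *)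

(* Defs.v *)
From HB Require Import structures.
From mathcomp Require Export all_boot all_order all_algebra.
From mathcomp Require Export all_classical all_reals all_analysis.

Set Implicit Arguments.
Unset Strict Implicit.
Unset Printing Implicit Defensive.

Import Order.TTheory GRing.Theory Num.Theory.
Import numFieldNormedType.Exports.

Local Open Scope classical_set_scope.
Local Open Scope ring_scope.

Definition mutually_independent (d : measure_display) (T : measurableType d)
    (R : realType) (P : probability T R) (I : eqType)
    (X : I -> {RV P >-> R}) : Prop :=
  forall (J : seq I) (B : I -> set R), uniq J ->
    (forall i, measurable (B i)) ->
    P (\bigcap_(i in [set` J]) (X i @^-1` B i)) =
    (\prod_(i <- J) P (X i @^-1` B i))%E.

(* The set functions are compared on Borel sets only: outside the sigma-algebra
   the values of a measure are unspecified. *)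
Definition iid_env (d : measure_display) (T : measurableType d)
    (R : realType) (P : probability T R) (xi : nat -> nat -> {RV P >-> R})
    (law : set R -> \bar R) : Prop :=
  mutually_independent (fun ij : nat * nat => xi ij.1 ij.2) /\
  forall (i j : nat) (B : set R), measurable B ->
    distribution P (xi i j) B = law B.

(* Sites are numbered from 0; a configuration s : {ffun 'I_N -> bool} encodes
   the spins sigma_i = (-1) ^ (s i). *)
Definition spin (R : realType) (N : nat) (s : {ffun 'I_N -> bool}) (i : 'I_N)
  : R := (-1) ^+ s i.

Definition hamiltonian (R : realType) (N : nat) (s : {ffun 'I_N -> bool})
    (x : nat -> nat -> R) : R :=
  \sum_(i < N) \sum_(j < N) x i j * spin R s i * spin R s j.

Definition partition_function (R : realType) (beta h : R) (N : nat)
    (x : nat -> nat -> R) : R :=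
  2 ^- N * \sum_(s : {ffun 'I_N -> bool})
    expR (beta / Num.sqrt N%:R * hamiltonian s x
          + h * \sum_(i < N) spin R s i).

Definition log_partition (d : measure_display) (T : measurableType d)
    (R : realType) (P : probability T R) (beta h : R)
    (xi : nat -> nat -> {RV P >-> R}) (N : nat) (w : T) : R :=
  ln (partition_function beta h N (fun i j => xi i j w)).

(* alpha_N, valued in \bar R so that nothing is lost when log Z_N is not
   known to be integrable. *)
Definition mean_free_energy (d : measure_display) (T : measurableType d)
    (R : realType) (P : probability T R) (beta h : R)
    (xi : nat -> nat -> {RV P >-> R}) (N : nat) : \bar R :=
  (N%:R^-1%:E * 'E_P[log_partition beta h xi N])%E.

(* Convergence of log Z_N / N to the constant a, almost surely and in average. *)
Definition free_energy_limit (d : measure_display) (T : measurableType d)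
    (R : realType) (P : probability T R) (beta h : R)
    (xi : nat -> nat -> {RV P >-> R}) (a : R) : Prop :=
  {ae P, forall w : T,
    (fun N : nat => N%:R^-1 * log_partition beta h xi N w) @ \oo --> a} /\
  mean_free_energy beta h xi @ \oo --> a%:E.

(* Main.v *)
(* Put b = beta / sqrt N.  As a function of a single coupling v, log Z_N is
   ln (A e^(bv) + B e^(-bv)) with A, B >= 0, which is a quadratic polynomial in
   v up to an error 2 b^3 |v|^3.  Hence replacing the N^2 couplings one at a
   time by Gaussian ones, which have the same first two moments, changes
   E[log Z_N] by at most 2 b^3 (E|xi|^3 + E|g|^3) per coupling; as
   E|g|^3 <= 2 <= 2 E|xi|^3, the free energies differ by at most
   6 E|xi|^3 beta^3 / sqrt N.

   For almost sure convergence, let H = log Z_N(xi) - E[log Z_N(xi)] and let xi'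
   be an independent copy of xi.  Then E|H|^3 = E[H |H| (log Z_N(xi) -
   log Z_N(xi'))].  Telescope the difference over the couplings: each term is
   antisymmetric under the exchange of xi_k and xi'_k, so only the variation of
   H |H| under this exchange matters, and each term is
   O(b^2 E[|xi_k - xi'_k|^2 |H|]).  Summing up, E|H|^3 = O(N^(3/2)); thus
   E|H / N|^3 is summable and H / N tends to 0 almost surely. *)
From HB Require Import structures.
Require Import Defs.
From mathcomp Require Import measurable_realfun ring lra.
Import Order.TTheory GRing.Theory Num.Theory.
Import numFieldNormedType.Exports.

Set Implicit Arguments.
Unset Strict Implicit.
Unset Printing Implicit Defensive.

Local Open Scope classical_set_scope.
Local Open Scope ring_scope.

(** * Independent families and their joint law *)

(** The free energy enters through two properties only: it is Lipschitz with constant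
    [beta / sqrt N] for the l1 norm of the couplings, and it has a cubic expansion in each of them.
    Replacement and concentration are therefore proved for an abstract function on R^I with I
    finite. The obstacle is that the environments live on unrelated probability spaces and only
    their laws are known. A fresh copy of a variable is obtained by passing to a product space, and
    expectations are compared through the joint law on R^I, which independence and the marginals
    determine. *)

Lemma eq_law_integral (R : realType) d1 d2 d3 (T1 : measurableType d1)
    (T2 : measurableType d2) (E : measurableType d3)
    (P1 : {measure set T1 -> \bar R}) (P2 : {measure set T2 -> \bar R})
    (phi1 : T1 -> E) (phi2 : T2 -> E) (f : E -> \bar R) :
  measurable_fun setT phi1 -> measurable_fun setT phi2 ->
  measurable_fun setT f ->
  (forall A, measurable A -> P1 (phi1 @^-1` A) = P2 (phi2 @^-1` A)) ->
  (\int[P1]_w f (phi1 w) = \int[P2]_w f (phi2 w))%E.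
Proof.
move=> m1 m2 mf P12.
have ge0 (g : E -> \bar R) : measurable_fun setT g -> (forall x, 0 <= g x)%E ->
    (\int[P1]_w g (phi1 w) = \int[P2]_w g (phi2 w))%E.
  move=> mg g0.
  have := ge0_integral_pushforward m1 P1 measurableT mg (fun y _ => g0 y).
  have := ge0_integral_pushforward m2 P2 measurableT mg (fun y _ => g0 y).
  rewrite !preimage_setT => <- <-.
  by apply: eq_measure_integral => A mA _; exact: P12.
rewrite [LHS]integralE [RHS]integralE; congr (_ - _)%E.
- rewrite -[X in (X^\+)%E]/(f \o phi1) -[X in _ = (\int[P2]_x X^\+ x)%E]/(f \o phi2).
  rewrite (funepos_comp f phi1) (funepos_comp f phi2).
  by apply: ge0 => //; exact: measurable_funepos.
- rewrite -[X in (X^\-)%E]/(f \o phi1) -[X in _ = (\int[P2]_x X^\- x)%E]/(f \o phi2).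
  rewrite (funeneg_comp f phi1) (funeneg_comp f phi2).
  by apply: ge0 => //; exact: measurable_funeneg.
Qed.

Lemma eq_law_integrable (R : realType) d1 d2 d3 (T1 : measurableType d1)
    (T2 : measurableType d2) (E : measurableType d3)
    (P1 : {measure set T1 -> \bar R}) (P2 : {measure set T2 -> \bar R})
    (phi1 : T1 -> E) (phi2 : T2 -> E) (f : E -> \bar R) :
  measurable_fun setT phi1 -> measurable_fun setT phi2 ->
  measurable_fun setT f ->
  (forall A, measurable A -> P1 (phi1 @^-1` A) = P2 (phi2 @^-1` A)) ->
  P2.-integrable setT (fun w => f (phi2 w)) ->
  P1.-integrable setT (fun w => f (phi1 w)).
Proof.
move=> m1 m2 mf P12 /integrableP[_ f2]; apply/integrableP; split.
  exact: measurableT_comp.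
rewrite (eq_law_integral (P2 := P2) (f := fun x => `|f x|%E) m1 m2)//.
exact: measurableT_comp.
Qed.

Section product_space.
Variables (R : realType) (I : finType).

(* Measurable boxes form a pi-system, so they determine the law of a family;
   [prodR] is the product sigma-algebra on R^I. *)
Definition boxes : set (set (I -> R)) :=
  [set A | exists B : I -> set R, (forall i, measurable (B i)) /\
    A = [set y | forall i, B i (y i)]].

Definition prodR := g_sigma_algebraType boxes.

HB.instance Definition _ := Measurable.on prodR.

Lemma measurable_proj (i : I) : measurable_fun setT (fun y : prodR => y i).
Proof.
move=> _ B mB; rewrite setTI; apply: sub_sigma_algebra.
exists (fun j => if j == i then B else setT); split.
  by move=> j; case: ifP.
apply/seteqP; split=> y /=.
  by move=> By j; case: ifP => // /eqP->.
by move=> /(_ i); rewrite eqxx.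
Qed.

Lemma measurable_box d (T : measurableType d) (Y : I -> T -> R) (B : I -> set R) :
  (forall i, measurable_fun setT (Y i)) -> (forall i, measurable (B i)) ->
  measurable [set w | forall i, B i (Y i w)].
Proof.
move=> mY mB.
rewrite (_ : [set _ | _] = \bigcap_(i in [set: I]) (Y i @^-1` B i)); last first.
  by apply/seteqP; split=> w /= Bw i; [move=> _|]; apply: Bw.
apply: fin_bigcap_measurable => // i _.
by rewrite -[X in measurable X]setTI; exact: mY.
Qed.

Lemma measurable_prodR d (T : measurableType d) (Y : T -> prodR) :
  (forall i, measurable_fun setT (fun w => Y w i)) -> measurable_fun setT Y.
Proof.
move=> mY; apply: (@measurability _ _ _ prodR _ _ boxes) => // _ [_ [B [mB ->]] <-].
rewrite setTI; exact: (measurable_box (Y := fun i w => Y w i)).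
Qed.

(** Full boxes are enough: a coordinate is dropped from the product by taking [B i = setT], of
    probability one. *)
Definition independent d (T : measurableType d) (P : {measure set T -> \bar R})
    (Y : I -> T -> R) :=
  (forall i, measurable_fun setT (Y i)) /\
  forall B : I -> set R, (forall i, measurable (B i)) ->
    P [set w | forall i, B i (Y i w)] = (\prod_i P (Y i @^-1` B i))%E.

Definition eq_marginals d1 (T1 : measurableType d1) d2 (T2 : measurableType d2)
    (P1 : {measure set T1 -> \bar R}) (P2 : {measure set T2 -> \bar R})
    (Y1 : T1 -> R) (Y2 : T2 -> R) :=
  forall B : set R, measurable B -> P1 (Y1 @^-1` B) = P2 (Y2 @^-1` B).

Lemma independent_law d1 (T1 : measurableType d1) d2 (T2 : measurableType d2)
    (P1 : probability T1 R) (P2 : probability T2 R)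
    (Y1 : I -> T1 -> R) (Y2 : I -> T2 -> R) :
  independent P1 Y1 -> independent P2 Y2 ->
  (forall i, eq_marginals P1 P2 (Y1 i) (Y2 i)) ->
  forall A : set prodR, measurable A ->
  P1 ((fun w => Y1^~ w) @^-1` A) = P2 ((fun w => Y2^~ w) @^-1` A).
Proof.
move=> [mY1 ind1] [mY2 ind2] Y12.
pose m1 : measurable_fun setT (fun w => (Y1^~ w : prodR)) := measurable_prodR mY1.
pose m2 : measurable_fun setT (fun w => (Y2^~ w : prodR)) := measurable_prodR mY2.
move=> A mA.
(* Uniqueness of measures asks for an exhaustion of the space by members of the pi-system of finite
   measure; the constant sequence [setT] serves. *)
have boxT : boxes setT.
  by exists (fun _ => setT); split => //; apply/seteqP; split.
pose q1 : {measure set prodR -> \bar R} := pushforward P1 (fun w => Y1^~ w : prodR).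
pose q2 : {measure set prodR -> \bar R} := pushforward P2 (fun w => Y2^~ w : prodR).
rewrite -[LHS]/(q1 m1 A) -[RHS]/(q2 m2 A).
apply: (@measure_unique _ R prodR boxes (fun _ => setT)) => //.
- move=> _ _ [B1 [mB1 ->]] [B2 [mB2 ->]].
  exists (fun i => B1 i `&` B2 i); split; first by move=> i; exact: measurableI.
  by apply/seteqP; split=> [y [b1 b2] i|y b]; split=> // i; have [] := b i.
- exact: bigcup_const.
- move=> _ [B [mB ->]]; rewrite /pushforward /=.
  rewrite [LHS](ind1 B mB) [RHS](ind2 B mB).
  by apply: eq_bigr => i _; exact: Y12.
- by move=> _; rewrite -[X in (X < _)%E]/(P1 setT) probability_setT ltry.
Qed.

End product_space.

(** * Product spaces as a source of independent copies *)

Section product_probability.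
Variables (R : realType) (d1 d2 : measure_display).
Variables (T1 : measurableType d1) (T2 : measurableType d2).
Variables (P1 : probability T1 R) (P2 : probability T2 R).

Lemma fst_law (A : set T1) : measurable A -> (P1 \x P2)%E (fst @^-1` A) = P1 A.
Proof.
move=> mA; rewrite (_ : fst @^-1` A = A `*` setT); last first.
  by apply/seteqP; split=> [[x y]|[x y] []].
by rewrite product_measure1E// -[RHS]mule1; congr (_ * _)%E; exact: probability_setT.
Qed.

Lemma snd_law (A : set T2) : measurable A -> (P1 \x P2)%E (snd @^-1` A) = P2 A.
Proof.
move=> mA; rewrite (_ : snd @^-1` A = setT `*` A); last first.
  by apply/seteqP; split=> [[x y]|[x y] []].
by rewrite product_measure1E// -[RHS]mul1e; congr (_ * _)%E; exact: probability_setT.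
Qed.

Lemma integral_fst (f : T1 -> \bar R) : measurable_fun setT f ->
  (\int[P1 \x P2]_w f w.1 = \int[P1]_w f w)%E.
Proof.
move=> mf; apply: (eq_law_integral (phi2 := id)) => //.
by move=> A mA; rewrite preimage_id; exact: fst_law.
Qed.

Lemma integrable_fst (f : T1 -> \bar R) : measurable_fun setT f ->
  P1.-integrable setT f -> (P1 \x P2)%E.-integrable setT (fun w => f w.1).
Proof.
move=> mf; apply: (eq_law_integrable (P2 := P1) (phi2 := id)) => //.
by move=> A mA; rewrite preimage_id; exact: fst_law.
Qed.

Lemma integral_snd (f : T2 -> \bar R) : measurable_fun setT f ->
  (\int[P1 \x P2]_w f w.2 = \int[P2]_w f w)%E.
Proof.
move=> mf; apply: (eq_law_integral (phi2 := id)) => //.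
by move=> A mA; rewrite preimage_id; exact: snd_law.
Qed.

Lemma integrable_snd (f : T2 -> \bar R) : measurable_fun setT f ->
  P2.-integrable setT f -> (P1 \x P2)%E.-integrable setT (fun w => f w.2).
Proof.
move=> mf; apply: (eq_law_integrable (P2 := P2) (phi2 := id)) => //.
by move=> A mA; rewrite preimage_id; exact: snd_law.
Qed.

Definition join (I1 I2 : finType) (Y1 : I1 -> T1 -> R) (Y2 : I2 -> T2 -> R)
    (i : I1 + I2) (w : T1 * T2) : R :=
  match i with inl i => Y1 i w.1 | inr i => Y2 i w.2 end.

Lemma independent_join (I1 I2 : finType) (Y1 : I1 -> T1 -> R)
    (Y2 : I2 -> T2 -> R) :
  independent P1 Y1 -> independent P2 Y2 ->
  independent (P1 \x P2)%E (join Y1 Y2).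
Proof.
move=> [mY1 ind1] [mY2 ind2]; split.
  by case=> i /=; apply: measurableT_comp.
move=> B mB; rewrite big_sumType /=.
rewrite (_ : [set w | _] = [set w | forall i, B (inl i) (Y1 i w)] `*`
    [set w | forall i, B (inr i) (Y2 i w)]); last first.
  apply/seteqP; split=> [w b|w [b1 b2] [] //].
  by split=> i; [have := b (inl i)|have := b (inr i)].
rewrite product_measure1E; [|exact: (measurable_box mY1 (fun i => mB (inl i)))
  |exact: (measurable_box mY2 (fun i => mB (inr i)))].
congr (_ * _)%E.
- rewrite [LHS](ind1 (fun i => B (inl i)))//; apply: eq_bigr => i _.
  apply/esym/(@fst_law (Y1 i @^-1` B (inl i))).
  by rewrite -[X in measurable X]setTI; exact: mY1.
- rewrite [LHS](ind2 (fun i => B (inr i)))//; apply: eq_bigr => i _.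
  apply/esym/(@snd_law (Y2 i @^-1` B (inr i))).
  by rewrite -[X in measurable X]setTI; exact: mY2.
Qed.

Definition upd (I : finType) (y : I -> R) (k : I) (v : R) (i : I) : R :=
  if i == k then v else y i.

(** The box is a rectangle of the product space: the constraint on [k] falls on the second factor
    alone, and the first factor keeps a box whose side [k] is the whole line. *)
Lemma independent_upd (I : finType) (Y : I -> T1 -> R) (k : I) (V : T2 -> R) :
  independent P1 Y -> measurable_fun setT V ->
  independent (P1 \x P2)%E (fun i w => upd (Y^~ w.1) k (V w.2) i).
Proof.
move=> [mY indY] mV; split.
  move=> i; rewrite /upd; case: eqP => [_|_]; exact: measurableT_comp.
move=> B mB; rewrite (bigD1 k)//= /upd eqxx.
rewrite (_ : [set w | _] = [set w | forall i, (if i == k then setT else B i) (Y i w)]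
     `*` (V @^-1` B k)); last first.
  apply/seteqP; split=> [w b|w [b1 b2] i].
    split; last by have := b k; rewrite eqxx.
    by move=> i; have := b i; case: eqP.
  by have := b1 i; case: eqP => [->|].
have mVB : measurable (V @^-1` B k) by rewrite -[X in measurable X]setTI; exact: mV.
have mB' i : measurable (if i == k then setT else B i) by case: ifP.
rewrite product_measure1E//; last exact: (measurable_box mY mB').
rewrite muleC; congr (_ * _)%E; first exact/esym/(@snd_law (V @^-1` B k)).
rewrite [LHS](indY (fun i => if i == k then setT else B i))//.
rewrite (bigD1 k)//= eqxx preimage_setT probability_setT mul1e.
apply: eq_bigr => i ik; rewrite (negbTE ik).
apply/esym/(@fst_law (Y i @^-1` B i)).
by rewrite -[X in measurable X]setTI; exact: mY.
Qed.

Lemma upd_marginals (I : finType) (Y : I -> T1 -> R) (k : I) (V : T2 -> R) :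
  independent P1 Y -> measurable_fun setT V -> forall i,
  if i == k then
    eq_marginals (P1 \x P2)%E P2 (fun w => upd (Y^~ w.1) k (V w.2) i) V
  else eq_marginals (P1 \x P2)%E P1 (fun w => upd (Y^~ w.1) k (V w.2) i) (Y i).
Proof.
move=> [mY indY] mV i; rewrite /upd; case: eqP => _ B mB.
- apply: (@snd_law (V @^-1` B)).
  by rewrite -[X in measurable X]setTI; exact: mV.
- apply: (@fst_law (Y i @^-1` B)).
  by rewrite -[X in measurable X]setTI; exact: mY.
Qed.

End product_probability.

Lemma independent_reindex (R : realType) d (T : measurableType d)
    (P : probability T R) (I : finType) (Y : I -> T -> R) (f : I -> I) :
  injective f -> independent P Y -> independent P (fun i => Y (f i)).
Proof.
move=> fI [mY indY]; split => // B mB.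
pose g := invF fI.
have fK : cancel f g by exact: invF_f.
have gK : cancel g f by exact: f_invF.
rewrite (_ : [set w | _] = [set w | forall i, B (g i) (Y i w)]); last first.
  apply/seteqP; split=> w /= b i.
    by have := b (g i); rewrite gK.
  by have := b (f i); rewrite fK.
rewrite (indY (fun i => B (g i)))// (reindex_inj fI) /=.
by apply: eq_bigr => i _; rewrite fK.
Qed.

Section resample.
Variables (R : realType) (I : finType).

(** This lets the coordinate [k] be treated as a variable living on a separate factor, which can be
    integrated out first while the other coordinates are frozen. *)
Lemma resample_law d1 (T1 : measurableType d1) d2 (T2 : measurableType d2)
    (P1 : probability T1 R) (P2 : probability T2 R) (Y : I -> T1 -> R) (k : I)
    (V : T2 -> R) :
  independent P1 Y -> measurable_fun setT V -> eq_marginals P2 P1 V (Y k) ->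
  forall A : set (prodR R I), measurable A ->
  (P1 \x P2)%E ((fun w => upd (Y^~ w.1) k (V w.2)) @^-1` A) =
  P1 ((fun w => Y^~ w) @^-1` A).
Proof.
move=> iY mV VY.
apply: (independent_law (independent_upd P2 k iY mV) iY) => i B mB.
have := upd_marginals P2 k iY mV i; case: (eqVneq i k) => [->|_] H.
  exact: (etrans (H B mB) (VY B mB)).
exact: H.
Qed.

Lemma resample d1 (T1 : measurableType d1) d2 (T2 : measurableType d2)
    (P1 : probability T1 R) (P2 : probability T2 R) (Y : I -> T1 -> R) (k : I)
    (V : T2 -> R) (F : prodR R I -> R) :
  independent P1 Y -> measurable_fun setT V -> eq_marginals P2 P1 V (Y k) ->
  measurable_fun setT F -> P1.-integrable setT (fun w => (F (Y^~ w))%:E) ->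
  (P1 \x P2)%E.-integrable setT (fun w => (F (upd (Y^~ w.1) k (V w.2)))%:E) /\
  (\int[P1 \x P2]_w (F (upd (Y^~ w.1) k (V w.2)))%:E =
   \int[P1]_w (F (Y^~ w))%:E)%E.
Proof.
move=> iY mV VY mF iF; have law := resample_law iY mV VY.
have mF' : measurable_fun setT (EFin \o F) by exact/measurable_EFinP.
have m1 : measurable_fun setT
    (fun w : T1 * T2 => upd (Y^~ w.1) k (V w.2) : prodR R I).
  by apply: measurable_prodR; case: (independent_upd P2 k iY mV).
have m2 : measurable_fun setT (fun w => Y^~ w : prodR R I).
  by apply: measurable_prodR; case: iY.
split.
- exact: (eq_law_integrable (P2 := P1) (phi2 := fun w => Y^~ w : prodR R I)
    m1 m2 mF' law).
- exact: (eq_law_integral m1 m2 mF' law).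
Qed.

End resample.

(** * Lindeberg replacement *)

Section probability_integrals.
Variables (R : realType) (d : measure_display) (T : measurableType d).
Variable P : probability T R.
Implicit Types f g V : T -> R.

Definition inL1 f := P.-integrable setT (fun w => (f w)%:E).

Lemma inL1_dominated g f : inL1 g -> measurable_fun setT f ->
  (forall w, `|f w| <= g w) -> inL1 f.
Proof.
move=> ig mf fg; apply: (le_integrable measurableT _ _ ig).
  exact/measurable_EFinP.
by move=> w _ /=; rewrite lee_fin (le_trans (fg w))// ler_norm.
Qed.

Lemma inL1_cst r : inL1 (fun=> r).
Proof. exact: finite_measure_integrable_cst. Qed.

Lemma inL1D f g : inL1 f -> inL1 g -> inL1 (fun w => f w + g w).
Proof. by move=> jf jg; exact: (integrableD measurableT jf jg). Qed.

Lemma inL1B f g : inL1 f -> inL1 g -> inL1 (fun w => f w - g w).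
Proof. by move=> jf jg; exact: (integrableB measurableT jf jg). Qed.

Lemma inL1Zl r f : inL1 f -> inL1 (fun w => r * f w).
Proof. by move=> jf; exact: (integrableZl measurableT r jf). Qed.

Lemma inL1_norm f : inL1 f -> inL1 (fun w => `|f w|).
Proof. by move=> jf; exact: (integrable_abse jf). Qed.

Lemma inL1_sum (I : Type) (s : seq I) (f : I -> T -> R) :
  (forall i, inL1 (f i)) -> inL1 (fun w => \sum_(i <- s) f i w).
Proof.
move=> jf; elim: s => [|i s IH].
  by under eq_fun do rewrite big_nil; exact: inL1_cst.
by under eq_fun do rewrite big_cons; exact: inL1D.
Qed.

Lemma Rint_cst r : \int[P]_w r = r.
Proof.
rewrite Rintegral_cst// [X in fine X](_ : _ = 1%E) ?mulr1//.
exact: probability_setT.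
Qed.

Lemma RintD f g : inL1 f -> inL1 g ->
  \int[P]_w (f w + g w) = \int[P]_w f w + \int[P]_w g w.
Proof. exact: RintegralD. Qed.

Lemma RintB f g : inL1 f -> inL1 g ->
  \int[P]_w (f w - g w) = \int[P]_w f w - \int[P]_w g w.
Proof. exact: RintegralB. Qed.

Lemma RintZl r f : inL1 f -> \int[P]_w (r * f w) = r * \int[P]_w f w.
Proof. exact: RintegralZl. Qed.

Lemma Rint_sum (I : Type) (s : seq I) (f : I -> T -> R) :
  (forall i, inL1 (f i)) ->
  \int[P]_w (\sum_(i <- s) f i w) = \sum_(i <- s) \int[P]_w f i w.
Proof.
move=> jf; elim: s => [|i s IH].
  by under eq_Rintegral do rewrite big_nil; rewrite big_nil Rint_cst.
under eq_Rintegral do rewrite big_cons.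
by rewrite big_cons RintD ?IH//; exact: inL1_sum.
Qed.

Lemma le_Rint f g : inL1 f -> inL1 g -> (forall w, f w <= g w) ->
  \int[P]_w f w <= \int[P]_w g w.
Proof. by move=> jf jg fg; apply: le_Rintegral. Qed.

Lemma Rint_norm_le f g : inL1 f -> inL1 g -> (forall w, `|f w| <= g w) ->
  `|\int[P]_w f w| <= \int[P]_w g w.
Proof.
move=> jf jg fg; apply: (le_trans (le_normr_Rintegral measurableT jf)).
exact: (le_Rint (inL1_norm jf)).
Qed.

Lemma EFin_Rint f : inL1 f -> (\int[P]_w f w)%:E = (\int[P]_w (f w)%:E)%E.
Proof. by move=> jf; rewrite fineK//; exact: integrable_fin_num. Qed.

(** Both [x] and [x ^+ 2] are at most [1 + x ^+ 3] for [x >= 0], and constants are integrable on a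
    probability space. *)
Lemma inL1_of_cube V : measurable_fun setT V ->
  inL1 (fun w => `|V w| ^+ 3) -> inL1 V /\ inL1 (fun w => V w ^+ 2).
Proof.
move=> mV j3; have j13 := inL1D (inL1_cst 1) j3; split.
- apply: (inL1_dominated j13) => // w; set x := `|V w|.
  have x0 : 0 <= x by exact: normr_ge0.
  by have [x1|x1] := leP x 1; nra.
- apply: (inL1_dominated j13) => [|w]; first exact: measurable_funX.
  rewrite normrX; set x := `|V w|.
  have x0 : 0 <= x by exact: normr_ge0.
  by have [x1|x1] := leP x 1; nra.
Qed.

(** The law of [V] enters the approximating number only through its first two moments, so this
    number cancels when two laws sharing them are compared. *)
Lemma Rint_expansion V (f : R -> R) (c0 c1 c2 C : R) :
  measurable_fun setT V -> inL1 (fun w => `|V w| ^+ 3) ->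
  inL1 (fun w => f (V w)) ->
  (forall v, `|f v - (c0 + c1 * v + c2 * v ^+ 2)| <= C * `|v| ^+ 3) ->
  `|\int[P]_w f (V w) - (c0 + c1 * \int[P]_w V w + c2 * \int[P]_w (V w ^+ 2))|
    <= C * \int[P]_w (`|V w| ^+ 3).
Proof.
move=> mV j3 jf fC; have [j1 j2] := inL1_of_cube mV j3.
have jc1 := inL1Zl c1 j1; have jc2 := inL1Zl c2 j2.
have j0 := inL1_cst c0; have j01 := inL1D j0 jc1; have j012 := inL1D j01 jc2.
(* The whole polynomial becomes a single integral, the constant [c0] included since the total mass
   is 1; the claim is then a pointwise bound. *)
rewrite -RintZl// -RintZl// -[c0 in X in `|X|]Rint_cst -RintD// -RintD// -RintB//.
rewrite -RintZl//; apply: Rint_norm_le.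
- exact: inL1B.
- exact: inL1Zl.
- by move=> w; exact: fC.
Qed.

End probability_integrals.

Lemma independent_eq_Rint (R : realType) (I : finType)
    d1 (T1 : measurableType d1) d2 (T2 : measurableType d2)
    (P1 : probability T1 R) (P2 : probability T2 R)
    (Y1 : I -> T1 -> R) (Y2 : I -> T2 -> R) (F : prodR R I -> R) :
  measurable_fun setT F ->
  independent P1 Y1 -> independent P2 Y2 ->
  (forall i, eq_marginals P1 P2 (Y1 i) (Y2 i)) ->
  \int[P1]_w F (Y1^~ w) = \int[P2]_w F (Y2^~ w).
Proof.
move=> mF i1 i2 Y12; congr fine.
have mF' : measurable_fun setT (EFin \o F) by exact/measurable_EFinP.
apply: (eq_law_integral (phi1 := fun w => Y1^~ w : prodR R I)
  (phi2 := fun w => Y2^~ w : prodR R I) (f := EFin \o F)) => //.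
- by apply: measurable_prodR; case: i1.
- by apply: measurable_prodR; case: i2.
- exact: independent_law.
Qed.

Lemma eq_marginals_Rint (R : realType)
    d1 (T1 : measurableType d1) d2 (T2 : measurableType d2)
    (P1 : probability T1 R) (P2 : probability T2 R)
    (Y1 : T1 -> R) (Y2 : T2 -> R) (f : R -> R) :
  measurable_fun setT f -> measurable_fun setT Y1 -> measurable_fun setT Y2 ->
  eq_marginals P1 P2 Y1 Y2 ->
  \int[P1]_w f (Y1 w) = \int[P2]_w f (Y2 w).
Proof.
move=> mf m1 m2 Y12; congr fine.
apply: (eq_law_integral (phi1 := Y1) (phi2 := Y2) (f := EFin \o f)) => //.
exact/measurable_EFinP.
Qed.

Lemma eq_marginals_inL1 (R : realType)
    d1 (T1 : measurableType d1) d2 (T2 : measurableType d2)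
    (P1 : probability T1 R) (P2 : probability T2 R)
    (Y1 : T1 -> R) (Y2 : T2 -> R) (f : R -> R) :
  measurable_fun setT f -> measurable_fun setT Y1 -> measurable_fun setT Y2 ->
  eq_marginals P1 P2 Y1 Y2 ->
  inL1 P2 (fun w => f (Y2 w)) -> inL1 P1 (fun w => f (Y1 w)).
Proof.
move=> mf m1 m2 Y12.
apply: (eq_law_integrable (phi1 := Y1) (phi2 := Y2) (f := EFin \o f)) => //.
exact/measurable_EFinP.
Qed.

Lemma eq_marginals_sym (R : realType)
    d1 (T1 : measurableType d1) d2 (T2 : measurableType d2)
    (P1 : probability T1 R) (P2 : probability T2 R)
    (Y1 : T1 -> R) (Y2 : T2 -> R) :
  eq_marginals P1 P2 Y1 Y2 -> eq_marginals P2 P1 Y2 Y1.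
Proof. by move=> Y12 B mB; rewrite Y12. Qed.

(** Every section, not just almost every one, is asked to be integrable: the inner integral is then
    a real number at each point. Lipschitz functions of integrable variables satisfy this. *)
Lemma Rint_fubini (R : realType)
    d1 (T1 : measurableType d1) d2 (T2 : measurableType d2)
    (P1 : probability T1 R) (P2 : probability T2 R) (f : T1 * T2 -> R) :
  inL1 (P1 \x P2)%E f -> (forall w1, inL1 P2 (fun w2 => f (w1, w2))) ->
  inL1 P1 (fun w1 => \int[P2]_w2 f (w1, w2)) /\
  \int[(P1 \x P2)%E]_w f w = \int[P1]_w1 \int[P2]_w2 f (w1, w2).
Proof.
move=> jf jf2.
have inner w1 : (\int[P2]_w2 (f (w1, w2))%:E)%E = (\int[P2]_w2 f (w1, w2))%:E.
  by rewrite EFin_Rint.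
split.
- have := integrable_fubini_F jf; rewrite /fubini_F /=.
  by under eq_fun do rewrite inner.
- rewrite /Rintegral -(integral12_prod_meas1 jf) /fubini_F /=.
  by under eq_integral do rewrite inner.
Qed.

Section l1_lipschitz.
Variables (R : realType) (I : finType) (F : prodR R I -> R) (a : R).
Hypothesis mF : measurable_fun setT F.
Hypothesis lipF : forall y z : I -> R, `|F y - F z| <= a * \sum_i `|y i - z i|.

(** A Lipschitz function grows at most linearly, so it inherits the integrability of its
    arguments. *)
Lemma lipschitz_inL1 d (T : measurableType d) (P : probability T R)
    (Y : I -> T -> R) :
  (forall i, measurable_fun setT (Y i)) -> (forall i, inL1 P (Y i)) ->
  inL1 P (fun w => F (Y^~ w)).
Proof.
move=> mY jY.
have jS : inL1 P (fun w => `|F (fun=> 0)| + a * \sum_i `|Y i w|).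
  apply: inL1D; first exact: inL1_cst.
  by apply: inL1Zl; apply: inL1_sum => i; exact: inL1_norm.
apply: (inL1_dominated jS) => [|w].
  apply: (measurableT_comp (f := F) (g := fun w => Y^~ w : prodR R I)) => //.
  exact: measurable_prodR.
have := lipF (Y^~ w) (fun=> 0); under eq_bigr do rewrite subr0.
have := ler_normD (F (Y^~ w) - F (fun=> 0)) (F (fun=> 0)).
by rewrite subrK => + ?; lra.
Qed.

Lemma lipschitz_upd_inL1 d (T : measurableType d) (P : probability T R)
    (y : I -> R) (k : I) (V : T -> R) :
  measurable_fun setT V -> inL1 P V -> inL1 P (fun w => F (upd y k (V w))).
Proof.
move=> mV jV; apply: (lipschitz_inL1 (Y := fun i w => upd y k (V w) i)) => i.
- by rewrite /upd; case: eqP.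
- by rewrite /upd; case: eqP => // _; exact: inL1_cst.
Qed.

Section replacement.
Variable C : R.
Hypothesis expF : forall y k, exists c0 c1 c2, forall v,
  `|F (upd y k v) - (c0 + c1 * v + c2 * v ^+ 2)| <= C * `|v| ^+ 3.

Variables (dV : measure_display) (TV : measurableType dV) (PV : probability TV R).
Variables (dW : measure_display) (TW : measurableType dW) (PW : probability TW R).
Variables (V : TV -> R) (W : TW -> R).
Hypotheses (mV : measurable_fun setT V) (mW : measurable_fun setT W).
Hypotheses (jV : inL1 PV (fun w => `|V w| ^+ 3))
  (jW : inL1 PW (fun w => `|W w| ^+ 3)).
Hypothesis VW1 : \int[PV]_w V w = \int[PW]_w W w.
Hypothesis VW2 : \int[PV]_w (V w ^+ 2) = \int[PW]_w (W w ^+ 2).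

Let mVW := \int[PV]_w (`|V w| ^+ 3) + \int[PW]_w (`|W w| ^+ 3).

Lemma replacement_pointwise (y : I -> R) (k : I) :
  `|\int[PV]_w F (upd y k (V w)) - \int[PW]_w F (upd y k (W w))| <= C * mVW.
Proof.
have [c0 [c1 [c2 c]]] := expF y k.
have [jV1 _] := inL1_of_cube mV jV; have [jW1 _] := inL1_of_cube mW jW.
have := Rint_expansion mV jV (lipschitz_upd_inL1 y k mV jV1) c.
have := Rint_expansion mW jW (lipschitz_upd_inL1 y k mW jW1) c.
rewrite VW1 VW2 mulrDr; set x := (c0 + _ + _) => h1 h2.
rewrite (_ : _ - _ = (\int[PV]_w F (upd y k (V w)) - x)
   - (\int[PW]_w F (upd y k (W w)) - x)); last by ring.
by rewrite (le_trans (ler_normB _ _))// lerD.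
Qed.

Lemma Rint_upd d (T : measurableType d) (P : probability T R)
    dU (TU : measurableType dU) (PU : probability TU R) (U : TU -> R)
    (Y : I -> T -> R) (k : I) :
  independent P Y -> (forall i, inL1 P (Y i)) ->
  measurable_fun setT U -> inL1 PU U ->
  inL1 P (fun w => \int[PU]_u F (upd (Y^~ w) k (U u))) /\
  \int[(P \x PU)%E]_w F (upd (Y^~ w.1) k (U w.2)) =
  \int[P]_w \int[PU]_u F (upd (Y^~ w) k (U u)).
Proof.
move=> [mY _] jY mU jU.
have jF : inL1 (P \x PU)%E (fun w => F (upd (Y^~ w.1) k (U w.2))).
  apply: (lipschitz_inL1 (Y := fun i w => upd (Y^~ w.1) k (U w.2) i)) => i.
  - by rewrite /upd; case: eqP => _; exact: measurableT_comp.
  - rewrite /upd; case: eqP => _.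
    + have mEU : measurable_fun setT (EFin \o U) by exact/measurable_EFinP.
      exact: (integrable_snd P mEU jU).
    + have mEY : measurable_fun setT (EFin \o Y i).
        by apply/measurable_EFinP; exact: mY.
      exact: (integrable_fst PU mEY (jY i)).
by apply: (Rint_fubini jF) => w; exact: (lipschitz_upd_inL1 (Y^~ w) k mU jU).
Qed.

Lemma replacement_step d (T : measurableType d) (P : probability T R)
    (Y : I -> T -> R) (k : I) :
  independent P Y -> (forall i, inL1 P (Y i)) ->
  `|\int[(P \x PV)%E]_w F (upd (Y^~ w.1) k (V w.2))
   - \int[(P \x PW)%E]_w F (upd (Y^~ w.1) k (W w.2))| <= C * mVW.
Proof.
move=> iY jY.
have [jV1 _] := inL1_of_cube mV jV; have [jW1 _] := inL1_of_cube mW jW.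
have [j1 ->] := Rint_upd k iY jY mV jV1.
have [j2 ->] := Rint_upd k iY jY mW jW1.
rewrite -RintB// -(Rint_cst P (C * mVW)).
apply: Rint_norm_le; [exact: inL1B|exact: inL1_cst|].
by move=> w; exact: replacement_pointwise.
Qed.

(* The probability space changes at each replacement, from T to T * TW, so it
   is universally quantified in the induction. *)
Lemma lindeberg_replacement (n : nat) (S : {set I}) : #|S| = n ->
  forall d (T : measurableType d) (P : probability T R) (Y : I -> T -> R)
    d' (T' : measurableType d') (P' : probability T' R) (Z : I -> T' -> R),
  independent P Y ->
  (forall i, i \in S -> eq_marginals P PV (Y i) V) ->
  (forall i, i \notin S -> eq_marginals P PW (Y i) W) ->
  independent P' Z -> (forall i, eq_marginals P' PW (Z i) W) ->
  `|\int[P]_w F (Y^~ w) - \int[P']_w F (Z^~ w)| <= n%:R * (C * mVW).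
Proof.
elim: n S => [|n IH] S.
  (* When no coordinate of law [V] is left, both families have the same joint law. *)
  move=> /eqP; rewrite cards_eq0 => /eqP-> d T P Y d' T' P' Z iY _ YW iZ ZW.
  rewrite (independent_eq_Rint mF iY iZ) ?subrr ?normr0 ?mul0r// => i B mB.
  by rewrite (YW i) ?inE// ZW.
move=> cS d T P Y d' T' P' Z iY YV YW iZ ZW.
have [k kS] : exists k, k \in S by apply/card_gt0P; rewrite cS.
have [jV1 _] := inL1_of_cube mV jV; have [jW1 _] := inL1_of_cube mW jW.
have jY i : inL1 P (Y i).
  have [iS|iS] := boolP (i \in S).
  - by apply: (eq_marginals_inL1 (f := id) _ _ mV (YV i iS)) => //; case: iY.
  - by apply: (eq_marginals_inL1 (f := id) _ _ mW (YW i iS)) => //; case: iY.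
have jFY : inL1 P (fun w => F (Y^~ w)) by apply: lipschitz_inL1 => //; case: iY.
(* Drawing the coordinate [k] afresh from the law of [V] costs nothing; what remains is to exchange
   this draw for one from [W], after which [S] has lost [k]. *)
have [_ YE] := resample iY mV (eq_marginals_sym (YV k kS)) mF jFY.
have -> : \int[P]_w F (Y^~ w) = \int[(P \x PV)%E]_w F (upd (Y^~ w.1) k (V w.2)).
  by rewrite /Rintegral YE.
have iY' := independent_upd PW k iY mW.
have cS' : #|S :\ k| = n by have := cardsD1 k S; rewrite kS cS => -[].
have := IH _ cS' _ _ _ _ _ _ _ _ iY' _ _ iZ ZW.
have h1 i : i \in S :\ k ->
    eq_marginals (P \x PW)%E PV (fun w => upd (Y^~ w.1) k (W w.2) i) V.
  rewrite !inE => /andP[ik iS].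
  have := upd_marginals PW k iY mW i; rewrite (negbTE ik) => H B mB.
  by rewrite -(YV i iS B mB); exact: H.
have h2 i : i \notin S :\ k ->
    eq_marginals (P \x PW)%E PW (fun w => upd (Y^~ w.1) k (W w.2) i) W.
  rewrite !inE negb_and negbK => /orP ik.
  have := upd_marginals PW k iY mW i; case: ik => [->//|iS].
  have [//|_] := eqVneq i k => H B mB.
  by rewrite -(YW i iS B mB); exact: H.
move=> /(_ h1 h2) H.
have := replacement_step k iY jY.
set x := Rintegral _ _ _ in H *; set y := Rintegral _ _ _.
set z := Rintegral _ _ _ in H *.
move=> H'; rewrite (_ : y - z = (y - x) + (x - z)); last by ring.
rewrite (le_trans (ler_normD _ _))// -natr1 mulrDl mul1r addrC lerD//.
Qed.

End replacement.
End l1_lipschitz.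

(** * Concentration in the third moment *)

Section third_moments.
Variables (R : realType) (d : measure_display) (T : measurableType d).
Variable P : probability T R.
Implicit Types f g : T -> R.

(** Measurability is a separate clause, since integrability of the cube of [|f|] only makes [|f|]
    measurable. *)
Definition inL3 f := measurable_fun setT f /\ inL1 P (fun w => `|f w| ^+ 3).

Lemma cube_add_le (x y : R) : 0 <= x -> 0 <= y ->
  (x + y) ^+ 3 <= 4 * (x ^+ 3 + y ^+ 3).
Proof.
move=> x0 y0; rewrite -subr_ge0.
rewrite (_ : _ - _ = 3 * (x + y) * (x - y) ^+ 2); last by ring.
by rewrite mulr_ge0 ?sqr_ge0// mulr_ge0// addr_ge0.
Qed.

Lemma sqr_mul_le (x y : R) : 0 <= x -> 0 <= y ->
  x ^+ 2 * y <= x ^+ 3 + y ^+ 3.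
Proof.
move=> x0 y0; have [xy|/ltW yx] := leP x y.
- apply: (@le_trans _ _ (y ^+ 3)); last by rewrite lerDr exprn_ge0.
  by rewrite [leRHS]exprSr ler_wpM2r// lerXn2r.
- apply: (@le_trans _ _ (x ^+ 3)); last by rewrite lerDl exprn_ge0.
  by rewrite [leRHS]exprSr ler_wpM2l// exprn_ge0.
Qed.

Lemma inL3_dominated f g : inL3 g -> measurable_fun setT f ->
  (forall w, `|f w| <= g w) -> inL3 f.
Proof.
move=> [mg jg] mf fg; split => //; apply: (inL1_dominated jg).
  by apply: measurable_funX; exact: measurableT_comp.
move=> w; rewrite normrX normr_id lerXn2r ?nnegrE//.
by rewrite (le_trans (fg w))// ler_norm.
Qed.

Lemma inL3_cst r : inL3 (fun=> r).
Proof. by split => //; exact: inL1_cst. Qed.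

Lemma inL3D f g : inL3 f -> inL3 g -> inL3 (fun w => f w + g w).
Proof.
move=> [mf jf] [mg jg]; have mfg : measurable_fun setT (fun w => f w + g w).
  exact: measurable_funD.
split => //; apply: (inL1_dominated (inL1Zl 4 (inL1D jf jg))).
  by apply: measurable_funX; exact: measurableT_comp.
move=> w; rewrite normrX normr_id; apply: le_trans (cube_add_le _ _) => //.
by rewrite lerXn2r ?nnegrE ?addr_ge0// ler_normD.
Qed.

Lemma inL3Z r f : inL3 f -> inL3 (fun w => r * f w).
Proof.
move=> [mf jf]; split; first exact: measurable_funM.
by under eq_fun do rewrite normrM exprMn; exact: inL1Zl.
Qed.

Lemma inL3B f g : inL3 f -> inL3 g -> inL3 (fun w => f w - g w).
Proof.
move=> jf jg; have := inL3D jf (inL3Z (-1) jg).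
by under eq_fun do rewrite mulN1r.
Qed.

Lemma inL3_norm f : inL3 f -> inL3 (fun w => `|f w|).
Proof.
move=> [mf jf]; split; first exact: measurableT_comp.
by under eq_fun do rewrite normr_id.
Qed.

Lemma inL3_sum (I : Type) (s : seq I) (f : I -> T -> R) :
  (forall i, inL3 (f i)) -> inL3 (fun w => \sum_(i <- s) f i w).
Proof.
move=> jf; elim: s => [|i s IH].
  by under eq_fun do rewrite big_nil; exact: inL3_cst.
by under eq_fun do rewrite big_cons; exact: inL3D.
Qed.

Lemma inL3_inL1 f : inL3 f -> inL1 P f.
Proof. by move=> [mf jf]; have [] := inL1_of_cube mf jf. Qed.

(** The elementary bound [x^2 y <= x^3 + y^3] does the work of Hölder's inequality. The signed
    square [f * |f|] is the derivative of [|f|^3 / 3]. *)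
Lemma inL3_inL1_mul f g : inL3 f -> inL3 g -> inL1 P (fun w => f w * `|f w| * g w).
Proof.
move=> [mf jf] [mg jg]; apply: (inL1_dominated (inL1D jf jg)).
  apply: measurable_funM => //; apply: measurable_funM => //.
  exact: measurableT_comp.
by move=> w; rewrite !normrM normr_id -expr2 sqr_mul_le.
Qed.

End third_moments.

Section concentration.
Variables (R : realType) (I : finType) (F : prodR R I -> R) (a : R).
Hypothesis a_ge0 : 0 <= a.
Hypothesis mF : measurable_fun setT F.
Hypothesis lipF : forall y z : I -> R, `|F y - F z| <= a * \sum_i `|y i - z i|.

Variables (d : measure_display) (T : measurableType d) (P : probability T R).
Variable Y : I -> T -> R.
Hypothesis iY : independent P Y.
Hypothesis Y3 : forall i, inL1 P (fun w => `|Y i w| ^+ 3).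
Variable m : R.
Hypothesis Ym : forall i, \int[P]_w (`|Y i w| ^+ 3) <= m.

(** The two factors carry independent copies of the same family: the index [inl i] reads the first
    copy, [inr i] the second. *)
Let Q : probability (T * T)%type R := (P \x P)%E.
Let J : I + I -> T * T -> R := join Y Y.
Let iJ : independent Q J. Proof. exact: independent_join. Qed.

Definition swap (k : I) (s : I + I) : I + I :=
  match s with
  | inl i => if i == k then inr i else inl i
  | inr i => if i == k then inl i else inr i
  end.

Lemma swapK k : involutive (swap k).
Proof.
by case=> i /=; case: (eqVneq i k) => [->|ik] /=; rewrite ?eqxx// (negbTE ik).
Qed.

(** Exchangeability: both copies of the entry [k] have the same law and all entries are independent,
    so exchanging them preserves the joint law of the doubled family. *)
Lemma swap_Rint (k : I) (Phi : prodR R (I + I)%type -> R) :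
  measurable_fun setT Phi ->
  \int[Q]_w Phi (fun s => J (swap k s) w) = \int[Q]_w Phi (J^~ w).
Proof.
move=> mPhi; apply: (independent_eq_Rint mPhi _ iJ).
  exact: (independent_reindex (inv_inj (swapK k)) iJ).
have mYB i B : measurable B -> measurable (Y i @^-1` B).
  by move=> mB; rewrite -[X in measurable X]setTI; case: iY => mY _; exact: mY.
move=> [i|i] B mB /=; case: eqP => // _.
- exact: (etrans (snd_law P P (mYB i B mB)) (esym (fst_law P P (mYB i B mB)))).
- exact: (etrans (fst_law P P (mYB i B mB)) (esym (snd_law P P (mYB i B mB)))).
Qed.

Let inL3Y i : inL3 P (Y i). Proof. by split => //; case: iY. Qed.

Let inL3J s : inL3 Q (J s).
Proof.
split; first by case: iJ.
have mY3 i : measurable_fun setT (fun w => (`|Y i w| ^+ 3)%:E).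
  apply/measurable_EFinP/measurable_funX; apply: measurableT_comp => //.
  by case: iY => mY _; exact: mY.
by case: s => i; [exact: (integrable_fst P (mY3 i) (Y3 i))
  |exact: (integrable_snd P (mY3 i) (Y3 i))].
Qed.

Lemma lipschitz_inL3 d' (T' : measurableType d') (P' : probability T' R)
    (V : I -> T' -> R) :
  (forall i, inL3 P' (V i)) -> inL3 P' (fun w => F (V^~ w)).
Proof.
move=> jV.
have jS : inL3 P' (fun w => `|F (fun=> 0)| + a * \sum_i `|V i w|).
  apply: inL3D; first exact: inL3_cst.
  by apply: inL3Z; apply: inL3_sum => i; exact: inL3_norm.
apply: (inL3_dominated jS) => [|w].
  apply: (measurableT_comp (f := F) (g := fun w => V^~ w : prodR R I)) => //.
  by apply: measurable_prodR => i; case: (jV i).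
have := lipF (V^~ w) (fun=> 0); under eq_bigr do rewrite subr0.
have := ler_normD (F (V^~ w) - F (fun=> 0)) (F (fun=> 0)).
by rewrite subrK => + ?; lra.
Qed.

Let c := \int[P]_w F (Y^~ w).
Let M := \int[P]_w (`|F (Y^~ w) - c| ^+ 3).

(** The selector [f] decides, entry by entry, which of the two copies [F] reads. *)
Let sel (f : I -> I + I) (z : I + I -> R) : R := F (fun i => z (f i)).

Let msel f : measurable_fun setT (sel f : prodR R (I + I)%type -> R).
Proof.
apply: (measurableT_comp (f := F)
  (g := fun z : prodR R (I + I)%type => (fun i => z (f i)) : prodR R I)) => //.
by apply: measurable_prodR => i; exact: measurable_proj.
Qed.

Let inL3sel f : inL3 Q (fun w => sel f (J^~ w)).
Proof. by apply: (lipschitz_inL3 (V := fun i => J (f i))) => i; exact: inL3J. Qed.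

(* [sel (hyb n)] evaluates [F] at the family whose first n entries, in the
   order of [enum_rank], are resampled. *)
Let hyb (n : nat) (i : I) : I + I := if (enum_rank i < n)%N then inr i else inl i.

Let Delta n z := sel (hyb n) z - sel (hyb n.+1) z.
Let H z := sel inl z - c.

(** Consecutive hybrids differ only at the entry of rank [n], so exchanging the copies there turns
    each into the other. This is the source of the antisymmetry of [Delta n]. *)
Lemma swap_hyb (n : 'I_#|I|) i :
  swap (enum_val n) (hyb n i) = hyb n.+1 i /\
  swap (enum_val n) (hyb n.+1 i) = hyb n i.
Proof.
rewrite /hyb /swap; case: (eqVneq i (enum_val n)) => [->|ik].
  by rewrite enum_valK ltnn ltnSn /= eqxx.
have ne : (enum_rank i != n :> nat).
  by apply: contra_neq ik => /val_inj <-; rewrite enum_rankK.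
have -> : (enum_rank i < n.+1)%N = (enum_rank i < n)%N.
  by rewrite ltnS leq_eqVlt (negbTE ne).
by case: ifP; rewrite (negbTE ik).
Qed.

Let swap_Delta (n : 'I_#|I|) z :
  Delta n (fun s => z (swap (enum_val n) s)) = - Delta n z.
Proof.
rewrite /Delta /sel opprB; congr (F _ - F _); apply: funext => i.
- by have [-> _] := swap_hyb n i.
- by have [_ ->] := swap_hyb n i.
Qed.

Let sum_delta (u : I -> R) (k : I) : (forall i, i != k -> u i = 0) ->
  \sum_i u i = u k.
Proof. by move=> u0; rewrite (bigD1 k)//= big1 ?addr0. Qed.

Let Delta_le (n : 'I_#|I|) k z : k = enum_val n ->
  `|Delta n z| <= a * `|z (inl k) - z (inr k)|.
Proof.
move=> kE; apply: le_trans (lipF _ _) _; rewrite ler_wpM2l//.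
rewrite (sum_delta (k := k)); last first.
  move=> i ik; have [<- _] := swap_hyb n i; rewrite -kE /hyb.
  by case: ifP => _; rewrite /= (negbTE ik) subrr normr0.
have [<- _] := swap_hyb n k; rewrite -kE /hyb.
by case: ifP => _; rewrite /= eqxx// distrC.
Qed.

Let H_swap_le (k : I) z :
  `|H z - H (fun s => z (swap k s))| <= a * `|z (inl k) - z (inr k)|.
Proof.
rewrite /H opprB addrA subrK; apply: le_trans (lipF _ _) _; rewrite ler_wpM2l//.
rewrite (sum_delta (k := k)) /= ?eqxx// => i ik.
by rewrite (negbTE ik) subrr normr0.
Qed.

(** For equal signs this is the factorisation of [u^2 - v^2]; for opposite signs
    [|u - v| = |u| + |v|] and [u^2 + v^2] is at most its square. *)
Lemma mul_norm_lip (u v : R) :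
  `|u * `|u| - v * `|v| | <= `|u - v| * (`|u| + `|v|).
Proof.
have := ler_norm (u - v); have := ler_norm (v - u); rewrite [`|v - u|]distrC.
move: (`|u - v|) => e h1 h2; rewrite ler_norml.
by have [u0|u0] := ger0P u; have [v0|v0] := ger0P v; apply/andP; split; nra.
Qed.

(** A Young inequality with a free scale, obtained from [y / L]. A large [L] makes the weight of
    [y ^+ 3] small, which later allows the moment [M] to be absorbed. *)
Lemma sqr_mul_le_scaled (L x y : R) : 0 < L -> 0 <= x -> 0 <= y ->
  x ^+ 2 * y <= L * x ^+ 3 + y ^+ 3 / L ^+ 2.
Proof.
move=> L0 x0 y0; have yL0 : 0 <= y / L by rewrite divr_ge0// ltW.
have := ler_wpM2l (ltW L0) (sqr_mul_le x0 yL0).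
have -> : L * (x ^+ 2 * (y / L)) = x ^+ 2 * y by field; rewrite gt_eqF.
have -> : L * (x ^+ 3 + (y / L) ^+ 3) = L * x ^+ 3 + y ^+ 3 / L ^+ 2.
  by field; rewrite gt_eqF.
by [].
Qed.

(** Each factor contributes [a] times the distance between the two copies of entry [k]: one through
    the variation of the signed square of [H], one through [Delta n]. The second power of [a] is the
    gain of the symmetrisation. *)
Let swap_pointwise (L : R) (n : 'I_#|I|) k z H' : 0 < L -> k = enum_val n ->
  H' = H (fun s => z (swap k s)) ->
  (H z * `|H z| - H' * `|H'|) * Delta n z <=
  a ^+ 2 * (2 * L * `|z (inl k) - z (inr k)| ^+ 3
    + (L ^- 2) * (`|H z| ^+ 3 + `|H'| ^+ 3)).
Proof.
move=> L0 kE H'E; have := Delta_le z kE; have := H_swap_le k z.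
rewrite -H'E; set u := H z; set D := Delta n z; set dl := `|z _ - z _| => h1 h2.
have d0 : 0 <= dl by exact: normr_ge0.
have := mul_norm_lip u H'; set w := u * _ - _ => h3.
apply: (le_trans (ler_norm _)); rewrite normrM.
apply: (@le_trans _ _ ((a * dl * (`|u| + `|H'|)) * (a * dl))).
  apply: ler_pM => //; apply: (le_trans h3); by rewrite ler_wpM2r// addr_ge0.
rewrite (_ : _ * (a * dl) = a ^+ 2 * (dl ^+ 2 * `|u| + dl ^+ 2 * `|H'|));
  last by ring.
rewrite ler_wpM2l ?sqr_ge0//.
have := sqr_mul_le_scaled L0 d0 (normr_ge0 u).
have := sqr_mul_le_scaled L0 d0 (normr_ge0 H').
move=> g1 g2; apply: (le_trans (lerD g2 g1)).
by rewrite le_eqVlt; apply/orP; left; apply/eqP; ring.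
Qed.

Let inL3H : inL3 Q (fun w => H (J^~ w)).
Proof. by apply: inL3B; [exact: inL3sel|exact: inL3_cst]. Qed.

Let mH : measurable_fun setT (H : prodR R (I + I)%type -> R).
Proof. exact: measurable_funB. Qed.

Let inL3Delta n : inL3 Q (fun w => Delta n (J^~ w)).
Proof. by apply: inL3B; exact: inL3sel. Qed.

Let mDelta n : measurable_fun setT (Delta n : prodR R (I + I)%type -> R).
Proof. exact: measurable_funB. Qed.

Let inL3FY : inL3 P (fun w => F (Y^~ w)).
Proof. exact: lipschitz_inL3. Qed.

Let inL3FYc : inL3 P (fun w => F (Y^~ w) - c).
Proof. by apply: inL3B => //; exact: inL3_cst. Qed.

Let Rint_H : \int[Q]_w (`|H (J^~ w)| ^+ 3) = M.
Proof.
congr fine; apply: (integral_fst P P (f := fun w => (`|F (Y^~ w) - c| ^+ 3)%:E)).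
by case: inL3FYc => _ /measurable_int.
Qed.

Let Rint_dist k : \int[Q]_w (`|J (inl k) w - J (inr k) w| ^+ 3) <= 8 * m.
Proof.
have E s : \int[Q]_w (`|J s w| ^+ 3) <= m.
  case: s => i; apply: le_trans (Ym i); rewrite le_eqVlt; apply/orP; left;
    apply/eqP; congr fine; have [_ /measurable_int mY3] := inL3Y i.
  - exact: (integral_fst P P mY3).
  - exact: (integral_snd P P mY3).
have jl := (inL3J (inl k)).2; have jr := (inL3J (inr k)).2.
apply: (@le_trans _ _ (\int[Q]_w (4 * (`|J (inl k) w| ^+ 3 + `|J (inr k) w| ^+ 3)))).
  apply: le_Rint; first exact: (inL3B (inL3J _) (inL3J _)).2.
    exact: inL1Zl (inL1D jl jr).
  move=> w; apply: le_trans (cube_add_le _ _) => //.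
  by rewrite lerXn2r ?nnegrE ?addr_ge0// ler_normB.
rewrite RintZl; last exact: inL1D.
rewrite RintD//; have := E (inl k); have := E (inr k); lra.
Qed.

Let telescope_Delta z : sel inl z - sel inr z = \sum_(n < #|I|) Delta n z.
Proof.
rewrite -(big_mkord xpredT (fun n => Delta n z)).
under eq_bigr do rewrite /Delta -opprB.
(* The extreme hybrids are [inl], as no rank is below 0, and [inr], as every rank is below
   [#|I|]. *)
rewrite sumrN telescope_sumr// opprB; congr (F _ - F _); apply: funext => i.
by rewrite /hyb ltn_ord.
Qed.

Let Rint_H_Delta (L : R) (n : 'I_#|I|) : 0 < L ->
  \int[Q]_w (H (J^~ w) * `|H (J^~ w)| * Delta n (J^~ w)) <=
  a ^+ 2 * (8 * m * L + M / L ^+ 2).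
Proof.
move=> L0; pose k := enum_val n.
pose Phi z := H z * `|H z| * Delta n z.
pose Hs z := H (fun s => z (swap k s)).
have mPhi : measurable_fun setT (Phi : prodR R (I + I)%type -> R).
  apply: measurable_funM => //; apply: measurable_funM => //.
  exact: measurableT_comp.
have inL3Hs : inL3 Q (fun w => Hs (J^~ w)).
  apply: inL3B; last exact: inL3_cst.
  by apply: (lipschitz_inL3 (V := fun i => J (swap k (inl i)))) => i; exact: inL3J.
have RHs : \int[Q]_w (`|Hs (J^~ w)| ^+ 3) = M.
  rewrite -Rint_H -(swap_Rint k (Phi := fun z => `|H z| ^+ 3))//.
  by apply: measurable_funX; exact: measurableT_comp.
have sPhi w : Phi (fun s => J (swap k s) w) =
    - (Hs (J^~ w) * `|Hs (J^~ w)| * Delta n (J^~ w)).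
  by rewrite /Phi (swap_Delta n (J^~ w)) mulrN.
have jPhi : inL1 Q (fun w => Phi (J^~ w)) by exact: inL3_inL1_mul.
have jPhis : inL1 Q (fun w => Hs (J^~ w) * `|Hs (J^~ w)| * Delta n (J^~ w)).
  exact: inL3_inL1_mul.
(* The integral is added to its image under the exchange, which has the same value and in which
   [Delta n] has changed sign. *)
have dbl : 2 * \int[Q]_w Phi (J^~ w) = \int[Q]_w (Phi (J^~ w)
    - Hs (J^~ w) * `|Hs (J^~ w)| * Delta n (J^~ w)).
  rewrite RintB//.
  have : \int[Q]_w Phi (J^~ w) =
      \int[Q]_w (-1 * (Hs (J^~ w) * `|Hs (J^~ w)| * Delta n (J^~ w))).
    rewrite -(swap_Rint k mPhi); apply: eq_Rintegral => w _.
    by rewrite sPhi mulN1r.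
  by rewrite RintZl// => ->; ring.
have jd : inL1 Q (fun w => `|J (inl k) w - J (inr k) w| ^+ 3).
  exact: (inL3B (inL3J _) (inL3J _)).2.
have jHH := inL1D inL3H.2 inL3Hs.2.
rewrite -(ler_pM2l (ltr0Sn R 1)) -/(Phi _) dbl.
pose B w := a ^+ 2 * (2 * L * `|J (inl k) w - J (inr k) w| ^+ 3
    + (L ^- 2) * (`|H (J^~ w)| ^+ 3 + `|Hs (J^~ w)| ^+ 3)).
have jB0 := inL1D (inL1Zl (2 * L) jd) (inL1Zl (L ^- 2) jHH).
apply: (@le_trans _ _ (\int[Q]_w B w)).
  apply: le_Rint; [exact: inL1B|exact: inL1Zl|move=> w].
  rewrite /Phi -mulrBl; exact: swap_pointwise.
rewrite RintZl// RintD ?RintZl//; [|exact: inL1Zl|exact: inL1Zl].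
rewrite RintD//; [|exact: inL3H.2|exact: inL3Hs.2].
(* By exchangeability both cubes integrate to [M]; the factor 2 on the left then cancels those in
   [2 * L] and [M + M]. *)
rewrite Rint_H RHs mulrCA ler_wpM2l ?sqr_ge0//.
have := ler_wpM2l (ltW L0) (Rint_dist k).
set t := Rintegral _ _ _ => h; rewrite [M / _]mulrC; lra.
Qed.

(** Integrating out the second copy turns [sel inr] into its mean [c], and [u * |u| * u] is the cube
    of [|u|]. *)
Let third_moment_identity : M =
  \int[Q]_w (H (J^~ w) * `|H (J^~ w)| * (sel inl (J^~ w) - sel inr (J^~ w))).
Proof.
have jsel : inL3 Q (fun w => sel inl (J^~ w) - sel inr (J^~ w)).
  by apply: inL3B; exact: inL3sel.
have jf := inL3_inL1_mul inL3H jsel.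
have jFY := inL3_inL1 inL3FY.
have jc x := inL1_cst P x.
have [|_ ->] := Rint_fubini jf.
  move=> w1; pose u := F (Y^~ w1) - c.
  exact: (inL1Zl (u * `|u|) (inL1B (jc (F (Y^~ w1))) jFY)).
apply: eq_Rintegral => w1 _ /=; pose u := F (Y^~ w1) - c.
rewrite -/u -[RHS]/(\int[P]_w2 (u * `|u| * (F (Y^~ w1) - F (Y^~ w2)))).
rewrite RintZl; last exact: (inL1B (jc _) jFY).
rewrite RintB// Rint_cst -/c -/u.
by have [u0|u0] := ger0P u; ring.
Qed.

(** The scale [L] is chosen so that the [#|I|] terms [a ^+ 2 * M / L ^+ 2] add up to [M / 2]. What
    remains is [M <= 4 * m * L ^+ 3 + M / 2], and [M] is a real number, so half of it moves to the
    left. *)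
Lemma third_moment_concentration (L : R) :
  0 < L -> L ^+ 2 = 2 * #|I|%:R * a ^+ 2 -> M <= 8 * m * L ^+ 3.
Proof.
move=> L0 LE; have : M <= #|I|%:R * (a ^+ 2 * (8 * m * L + M / L ^+ 2)).
  rewrite {1}third_moment_identity.
  under eq_Rintegral do rewrite telescope_Delta mulr_sumr.
  rewrite Rint_sum; last by move=> n; exact: inL3_inL1_mul.
  apply: (@le_trans _ _ (\sum_(n < #|I|) a ^+ 2 * (8 * m * L + M / L ^+ 2))).
    by apply: ler_sum => n _; exact: Rint_H_Delta.
  by rewrite sumr_const card_ord -[leLHS]mulr_natl.
have L2 : 0 < L ^+ 2 by rewrite exprn_gt0.
rewrite mulrA (_ : _ * a ^+ 2 = L ^+ 2 / 2); last by rewrite LE; field.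
rewrite mulrDr (_ : _ / 2 * (M / _) = M / 2); last by field; rewrite gt_eqF.
rewrite (_ : L ^+ 2 / 2 * (8 * m * L) = 8 * m * L ^+ 3 / 2); last by field.
lra.
Qed.

End concentration.

(** * The free energy as a function of the couplings *)

(** The mean value theorem is used in place of integration: the factor [1 / (n + 1)] is given up,
    and iterating the lemma keeps the constant [K] unchanged. *)
Lemma is_derive_growth (R : realType) (f df : R -> R) (K : R) (n : nat) :
  (forall x : R, is_derive x 1 f (df x)) -> f 0 = 0 ->
  (forall x, `|df x| <= K * `|x| ^+ n) ->
  forall v, `|f v| <= K * `|v| ^+ n.+1.
Proof.
move=> fdf f0 Kdf v.
have K0 : 0 <= K.
  by have := le_trans (normr_ge0 _) (Kdf 1); rewrite normr1 expr1n mulr1.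
have cf a b : {within `[a, b], continuous f}.
  by apply: derivable_within_continuous => x _; exact: ex_derive.
have mvt a b : a <= b -> exists2 c, c \in `[a, b]%R & f b - f a = df c * (b - a).
  by move=> ab; apply: MVT_segment => // x _; exact: fdf.
have [v0|/ltW v0] := leP 0 v.
- have [c] := mvt 0 v v0; rewrite in_itv/= f0 !subr0 => /andP[c0 cv] ->.
  rewrite normrM [in leRHS]exprSr mulrA ler_wpM2r//.
  apply: (le_trans (Kdf c)); rewrite ler_wpM2l// lerXn2r ?nnegrE//.
  by rewrite !ger0_norm.
- have [c] := mvt v 0 v0; rewrite in_itv/= f0 !sub0r => /andP[vc c0] fE.
  rewrite -normrN fE normrM normrN [in leRHS]exprSr mulrA ler_wpM2r//.
  apply: (le_trans (Kdf c)); rewrite ler_wpM2l// lerXn2r ?nnegrE//.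
  by rewrite !ler0_norm// lerN2.
Qed.

(** * Third-order Taylor bound for the logarithm of two exponentials *)

Section two_exponentials.
Variables (R : realType) (A B b : R).
Hypotheses (A0 : 0 <= A) (B0 : 0 <= B) (AB : 0 < A + B) (b0 : 0 <= b).

(** [D' = b N] and [N' = b D], so [m] plays the role of a hyperbolic tangent: [(ln D)' = b m],
    [m' = b (1 - m^2)] and [|m| <= 1], uniformly in [A] and [B]. *)
Let D v := A * expR (b * v) + B * expR (- (b * v)).
Let N v := A * expR (b * v) - B * expR (- (b * v)).
Let m v := N v / D v.

Let D_gt0 v : 0 < D v.
Proof.
have e1 := expR_gt0 (b * v); have e2 := expR_gt0 (- (b * v)); rewrite /D.
have [A1|A1] := ltP 0 A.
  by rewrite ltr_pwDl ?mulr_gt0// mulr_ge0// ltW.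
have A_0 : A = 0 by apply/eqP; rewrite eq_le A1 A0.
by rewrite A_0 mul0r add0r mulr_gt0//; have := AB; rewrite A_0 add0r.
Qed.

Let m_le1 v : `|m v| <= 1.
Proof.
rewrite normrM normfV (gtr0_norm (D_gt0 v)) ler_pdivrMr// mul1r /N /D.
apply: (le_trans (ler_normB _ _)).
by rewrite !ger0_norm ?mulr_ge0 ?expR_ge0.
Qed.

Let is_derive_exp (s x : R) :
  is_derive x 1 (fun v : R => expR (s * v)) (s * expR (s * x)).
Proof.
have h : is_derive x 1 (fun v : R => s * v) s.
  by have := is_deriveZ s (is_derive_id x (1 : R)); rewrite scaler1.
by have := is_derive1_comp (is_derive_expR (s * x)) h; rewrite mulrC.
Qed.

Let is_derive_lin (p q x : R) : is_derive x 1
  (fun v : R => p * expR (b * v) + q * expR (- (b * v)))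
  (b * (p * expR (b * x) - q * expR (- (b * x)))).
Proof.
have h1 := is_deriveZ p (is_derive_exp b x).
have h2 := is_deriveZ q (is_derive_exp (- b) x).
have h3 := is_deriveD h1 h2.
rewrite (_ : (fun v : R => _) =
    (p \*: (fun v : R => expR (b * v)) + q \*: (fun v : R => expR (- b * v)))).
  by apply: (is_derive_eq h3); rewrite /GRing.scale /= !mulNr; ring.
by apply: funext => v; rewrite -[RHS]/(p * expR (b * v) + q * expR (- b * v)) mulNr.
Qed.

Let is_derive_D (x : R) : is_derive x 1 D (b * N x).
Proof. exact: is_derive_lin. Qed.

Let is_derive_N (x : R) : is_derive x 1 N (b * D x).
Proof.
have -> : N = fun v => A * expR (b * v) + (- B) * expR (- (b * v)).
  by apply: funext => v; rewrite mulNr.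
by apply: (is_derive_eq (is_derive_lin A (- B) x)); rewrite mulNr opprK.
Qed.

Let is_derive_m (x : R) : is_derive x 1 m (b * (1 - m x ^+ 2)).
Proof.
have Dx : D x != 0 by rewrite gt_eqF.
have h : is_derive x 1 m _ :=
  is_deriveM (is_derive_N x) (is_deriveV Dx (is_derive_D x)).
by apply: (is_derive_eq h); rewrite /m /GRing.scale /=; field.
Qed.

Let is_derive_lnD (x : R) : is_derive x 1 (fun v : R => ln (D v)) (b * m x).
Proof.
have h : is_derive x 1 (fun v : R => ln (D v)) _ :=
  is_derive1_comp (is_derive1_ln (D_gt0 x)) (is_derive_D x).
by apply: (is_derive_eq h); rewrite /m; ring.
Qed.

Let is_derive_poly2 (c1 c2 x : R) :
  is_derive x 1 (fun v : R => c1 * v + c2 * v ^+ 2) (c1 + c2 * (2 * x)).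
Proof.
have h : is_derive x 1 (fun v : R => c1 * v + c2 * v ^+ 2) _ :=
  is_deriveD (is_deriveZ c1 (is_derive_id x (1 : R)))
  (is_deriveZ c2 (is_deriveX 2 (is_derive_id x (1 : R)))).
by apply: (is_derive_eq h); rewrite /GRing.scale /=; ring.
Qed.

Let is_derive_sub2 (f : R -> R) (df c0 c1 c2 x : R) : is_derive x 1 f df ->
  is_derive x 1 (fun v => f v - (c0 + c1 * v + c2 * v ^+ 2))
    (df - (c1 + c2 * (2 * x))).
Proof.
move=> h; have := is_deriveB h (is_deriveD (is_derive_cst c0 x (1 : R))
  (is_derive_poly2 c1 c2 x)).
rewrite add0r; congr is_derive; apply: funext => v /=.
by rewrite /cst /= addrA.
Qed.

(** Taylor expansion at 0. The third derivative [- 2 b^3 m (1 - m^2)] is at most [2 b^3] in absolute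
    value, and this bound is carried up three times by [is_derive_growth]. *)
Lemma ln_two_exponentials_expansion : exists c0 c1 c2, forall v,
  `|ln (A * expR (b * v) + B * expR (- (b * v)))
    - (c0 + c1 * v + c2 * v ^+ 2)| <= 2 * b ^+ 3 * `|v| ^+ 3.
Proof.
(* [g] is the second derivative of [ln D], whence the coefficient [g 0 / 2] below. *)
pose g v := b ^+ 2 * (1 - m v ^+ 2).
have dg (x : R) : is_derive x 1 g (b ^+ 2 * (- (2 * m x * (b * (1 - m x ^+ 2))))).
  have h : is_derive x 1 g _ := is_deriveZ (b ^+ 2)
    (is_deriveB (is_derive_cst (1 : R) x (1 : R))
    (is_deriveX 2 (is_derive_m x))).
  by apply: (is_derive_eq h); rewrite /GRing.scale /=; ring.
have g_lip v : `|g v - g 0| <= 2 * b ^+ 3 * `|v| ^+ 1.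
  apply: (is_derive_growth (f := fun v => g v - g 0) (n := 0)
    (df := fun x => b ^+ 2 * (- (2 * m x * (b * (1 - m x ^+ 2)))))).
  - move=> x; have := is_derive_sub2 (g 0) 0 0 (dg x).
    rewrite mul0r addr0 subr0; congr is_derive; apply: funext => y.
    by rewrite !mul0r !addr0.
  - by rewrite subrr.
  - move=> x; rewrite expr0 mulr1.
    have b3 : 0 <= b ^+ 3 by rewrite exprn_ge0.
    rewrite (_ : _ * - _ = b ^+ 3 * (- 2 * m x * (1 - m x ^+ 2))); last by ring.
    rewrite normrM (ger0_norm b3) mulrC ler_wpM2r//.
    have := m_le1 x; rewrite !ler_norml => /andP[m1 m2].
    have w0 : 0 <= 1 - m x ^+ 2 by nra.
    have w1 : 1 - m x ^+ 2 <= 1 by rewrite gerBl sqr_ge0.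
    by move: (m x) (1 - _) m1 m2 w0 w1 => r w *; apply/andP; split; nra.
have m_lip v : `|b * m v - (b * m 0 + g 0 * v + 0 * v ^+ 2)|
    <= 2 * b ^+ 3 * `|v| ^+ 2.
  apply: (is_derive_growth (n := 1) (df := fun v => g v - g 0)
    (f := fun v => b * m v - (b * m 0 + g 0 * v + 0 * v ^+ 2))) => [x||//].
  - have := is_derive_sub2 (b * m 0) (g 0) 0 (is_deriveZ b (is_derive_m x)).
    by move=> h; apply: (is_derive_eq h); rewrite /g /GRing.scale /=; ring.
  - by ring.
exists (ln (D 0)), (b * m 0), (g 0 / 2) => v.
apply: (is_derive_growth (n := 2)
  (f := fun v => ln (D v) - (ln (D 0) + b * m 0 * v + g 0 / 2 * v ^+ 2))
  (df := fun v => b * m v - (b * m 0 + g 0 * v + 0 * v ^+ 2))) => [x||//].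
- have h := is_derive_sub2 (ln (D 0)) (b * m 0) (g 0 / 2) (is_derive_lnD x).
  by apply: (is_derive_eq h); field.
- by ring.
Qed.

End two_exponentials.

(** * Logarithms of sums of exponentials over sign patterns *)

Section log_sum_exp.
Variables (R : realType) (I S : finType) (s0 : S).
Variables (c : S -> R) (e : S -> I -> R) (b : R).
Hypotheses (c_gt0 : forall s, 0 < c s) (b_ge0 : 0 <= b).
Hypothesis e_sign : forall s i, e s i = 1 \/ e s i = -1.

Definition sum_exp (y : I -> R) : R := \sum_s c s * expR (b * \sum_i y i * e s i).

Definition log_sum_exp (y : prodR R I) : R := ln (sum_exp y).

Lemma sum_exp_gt0 y : 0 < sum_exp y.
Proof.
rewrite /sum_exp (bigD1 s0)//= ltr_pwDl ?mulr_gt0 ?expR_gt0//.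
by apply: sumr_ge0 => s _; rewrite mulr_ge0 ?expR_ge0// ltW.
Qed.

Lemma measurable_log_sum_exp : measurable_fun setT log_sum_exp.
Proof.
apply: measurableT_comp => //; apply: measurable_sum => s.
apply: measurable_funM => //; apply: measurableT_comp => //.
apply: measurable_funM => //; apply: measurable_sum => i.
by apply: measurable_funM => //; exact: measurable_proj.
Qed.

(** As the [e s i] are signs, every exponent moves by at most the same amount; the common factor
    leaves the sum, and the logarithm makes it additive. *)
Lemma sum_exp_le (y z : I -> R) :
  sum_exp y <= expR (b * \sum_i `|y i - z i|) * sum_exp z.
Proof.
rewrite /sum_exp mulr_sumr; apply: ler_sum => s _.
rewrite mulrCA ler_wpM2l ?(ltW (c_gt0 s))// -expRD ler_expR -mulrDr.
rewrite ler_wpM2l// -big_split /=; apply: ler_sum => i _.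
rewrite -lerBlDr -mulrBl; apply: (le_trans (ler_norm _)); rewrite normrM.
by case: (e_sign s i) => ->; rewrite ?normrN normr1 mulr1.
Qed.

Lemma log_sum_exp_lipschitz (y z : I -> R) :
  `|log_sum_exp y - log_sum_exp z| <= b * \sum_i `|y i - z i|.
Proof.
have le u v : log_sum_exp u <= b * \sum_i `|u i - v i| + log_sum_exp v.
  rewrite -[X in _ <= X + _]expRK -lnM ?posrE ?expR_gt0 ?sum_exp_gt0//.
  rewrite ler_ln ?posrE ?sum_exp_gt0 ?mulr_gt0 ?expR_gt0// ?sum_exp_gt0//.
  exact: sum_exp_le.
have := le y z; have := le z y; under eq_bigr do rewrite distrC.
by rewrite ler_norml => h1 h2; apply/andP; split; lra.
Qed.

Lemma log_sum_exp_expansion (y : I -> R) (k : I) : exists c0 c1 c2, forall v,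
  `|log_sum_exp (upd y k v) - (c0 + c1 * v + c2 * v ^+ 2)|
    <= 2 * b ^+ 3 * `|v| ^+ 3.
Proof.
pose w s := c s * expR (b * \sum_(i | i != k) y i * e s i).
have w_gt0 s : 0 < w s by rewrite mulr_gt0// expR_gt0.
(* One of the sums may be empty: at a diagonal coupling the product of the spin with itself is
   always 1, and [B] vanishes. Only [A + B] is sure to be positive. *)
pose A := \sum_(s | e s k == 1) w s; pose B := \sum_(s | e s k != 1) w s.
have A0 : 0 <= A by apply: sumr_ge0 => s _; exact: ltW.
have B0 : 0 <= B by apply: sumr_ge0 => s _; exact: ltW.
have AB : 0 < A + B.
  rewrite -(bigID (fun s => e s k == 1) predT w) (bigD1 s0)//= ltr_pwDl//.
  by apply: sumr_ge0 => s _; exact: ltW.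
have [c0 [c1 [c2 h]]] := ln_two_exponentials_expansion A0 B0 AB b_ge0.
exists c0, c1, c2 => v; rewrite /log_sum_exp.
rewrite (_ : sum_exp _ = A * expR (b * v) + B * expR (- (b * v))); first exact: h.
have E s : c s * expR (b * \sum_i upd y k v i * e s i)
    = w s * expR (b * (v * e s k)).
  have -> : \sum_i upd y k v i * e s i =
      \sum_(i | i != k) y i * e s i + v * e s k.
    rewrite [RHS]addrC (bigD1 k)//=; congr (_ + _); first by rewrite /upd eqxx.
    by apply: eq_bigr => i ik; rewrite /upd (negbTE ik).
  by rewrite /w mulrDr expRD mulrA.
rewrite /sum_exp (eq_bigr _ (fun s _ => E s)) (bigID (fun s => e s k == 1))/=.
rewrite /A /B !mulr_suml; congr (_ + _); apply: eq_bigr => s es.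
  by rewrite (eqP es) mulr1.
by case: (e_sign s k) es => ->; rewrite ?eqxx// mulrN1 mulrN.
Qed.

End log_sum_exp.

Section free_energy.
Variables (R : realType) (beta h : R) (N : nat).

Let b := beta / Num.sqrt N%:R.
Let site := ('I_N * 'I_N)%type.
Let e (s : {ffun 'I_N -> bool}) (k : site) : R := spin R s k.1 * spin R s k.2.
(** The normalisation and the external field do not involve the couplings, so they are absorbed into
    positive weights. *)
Let c (s : {ffun 'I_N -> bool}) : R := 2 ^- N * expR (h * \sum_(i < N) spin R s i).

Definition free_energy : prodR R site -> R := log_sum_exp c e b.

Lemma spin_product_sign s k : e s k = 1 \/ e s k = -1.
Proof.
by rewrite /e /spin; case: (s _); case: (s _);
  rewrite ?expr0 ?expr1 ?mulr1 ?mul1r ?mulrNN ?mulr1; [left|right|right|left].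
Qed.

Lemma spin_weight_gt0 s : 0 < c s.
Proof. by rewrite mulr_gt0 ?expR_gt0// invr_gt0 exprn_gt0. Qed.

Lemma log_partitionE d (T : measurableType d) (P : probability T R)
    (xi : nat -> nat -> {RV P >-> R}) w :
  log_partition beta h xi N w = free_energy (fun k : site => xi k.1 k.2 w).
Proof.
rewrite /log_partition /free_energy /log_sum_exp /sum_exp /partition_function.
rewrite mulr_sumr; congr ln; apply: eq_bigr => s _.
rewrite /c expRD [X in _ * X = _]mulrC mulrA; congr (_ * expR (_ * _)).
by rewrite /hamiltonian pair_bigA /=; apply: eq_bigr => k _; rewrite mulrA.
Qed.

End free_energy.

(** * Gaussian moments *)

Section gaussian_moments.
Variable R : realType.
Let mu : {measure set (measurableTypeR R) -> \bar R} := @lebesgue_measure R.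
Let p : R -> R := normal_pdf 0 1.
Let gamma : probability (measurableTypeR R) R := normal_prob (0 : R) 1.

Let pE x : p x = normal_peak 1 * expR (- (x ^+ 2 / 2)).
Proof. by rewrite /p normal_pdfE ?oner_neq0// /normal_fun subr0 expr1n mulNr. Qed.

Let p_ge0 x : 0 <= p x. Proof. exact: normal_pdf_ge0. Qed.

Let p_even x : p (- x) = p x. Proof. by rewrite !pE sqrrN. Qed.

Let p0_ge0 : 0 <= normal_peak (1 : R). Proof. exact: normal_peak_ge0. Qed.

Let p_cont : continuous p. Proof. exact/continuous_normal_pdf/oner_neq0. Qed.

Let p_meas : measurable_fun setT p. Proof. exact: measurable_normal_pdf. Qed.

Let is_derive_p (x : R) : is_derive x 1 p (- x * p x).
Proof.
have h1 : is_derive x 1 (fun y : R => - (y ^+ 2 / 2)) (- x).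
  have h := is_deriveZ (- 2^-1) (is_deriveX 2 (is_derive_id x (1 : R))).
  rewrite (_ : (fun y : R => _) = - 2^-1 \*: (id : R -> R) ^+ 2).
    by apply: (is_derive_eq h); rewrite /GRing.scale /=; field.
  by apply: funext => y; rewrite -[RHS]/(- 2^-1 * y ^+ 2); field.
have h2 := is_deriveZ (normal_peak 1) (is_derive1_comp (is_derive_expR _) h1).
rewrite (_ : p = normal_peak 1 \*: (expR \o (fun y : R => - (y ^+ 2 / 2)))).
  apply: (is_derive_eq h2).
  rewrite -[RHS]/(- x * (normal_peak 1 * expR (- (x ^+ 2 / 2)))) /GRing.scale /=.
  by ring.
by apply: funext => y; rewrite pE.
Qed.

(** Up to sign, the left side is the primitive of [x^3 p], which has to vanish at infinity. With
    [y = x^2 / 2], squaring [e^(y/2) >= 1 + y/2] bounds [e^y] below by [(1 + x^2 / 4)^2]; one factor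
    absorbs [x^2 + 2], the other exceeds [x]. *)
Let p_decay (x : R) : 0 < x -> (x ^+ 2 + 2) * p x <= 4 * normal_peak 1 * x^-1.
Proof.
move=> x0; rewrite pE mulrCA [leRHS]mulrAC [leRHS]mulrC ler_wpM2l//.
set y := x ^+ 2 / 2; have y0 : 0 <= y by rewrite divr_ge0 ?sqr_ge0.
have ey : (1 + y / 2) ^+ 2 <= expR y.
  have {2}-> : y = y / 2 + y / 2 by field.
  rewrite expRD -expr2 lerXn2r ?nnegrE ?expR_ge0 ?expR_ge1Dx//.
  by rewrite addr_ge0// divr_ge0.
have pos : 0 < (1 + y / 2) ^+ 2 by rewrite exprn_gt0// ltr_pwDl// divr_ge0.
rewrite expRN; apply: (@le_trans _ _ ((x ^+ 2 + 2) / (1 + y / 2) ^+ 2)).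
  by rewrite ler_wpM2l ?addr_ge0 ?sqr_ge0// lef_pV2 ?posrE ?expR_gt0.
rewrite ler_pdivrMr// mulrAC ler_pdivlMr// /y.
have -> : (1 + x ^+ 2 / 2 / 2) ^+ 2 = (1 + x ^+ 2 / 4) * (1 + x ^+ 2 / 4) by field.
have h : x <= 1 + x ^+ 2 / 4 by have := sqr_ge0 (x / 2 - 1); nra.
have h' : x ^+ 2 + 2 <= 4 * (1 + x ^+ 2 / 4) by lra.
rewrite mulrA; apply: ler_pM => //; first by rewrite addr_ge0// sqr_ge0.
exact: ltW.
Qed.

Let cvg_inv : (4 * normal_peak 1 * x^-1 : R) @[x --> +oo] --> (0 : R).
Proof.
rewrite -[X in _ --> X](mulr0 (4 * normal_peak 1)).
apply: cvgM; first exact: cvg_cst.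
have := @gtr0_cvgV0 R _ (pinfty_nbhs R) _ (id : R -> R).
by move=> H; apply/H; [exact: nbhs_pinfty_gt|exact: cvg_id].
Qed.

Let cvg_sqr_p : (x ^+ 2 + 2) * p x @[x --> +oo] --> (0 : R).
Proof.
apply: (squeeze_cvgr _ (cvg_cst (0 : R)) cvg_inv).
near=> x; rewrite p_decay ?andbT; last by near: x; exact: nbhs_pinfty_gt.
by rewrite mulr_ge0// addr_ge0// sqr_ge0.
Unshelve. all: by end_near. Qed.

Let cvg_id_p : x * p x @[x --> +oo] --> (0 : R).
Proof.
apply: (squeeze_cvgr _ (cvg_cst (0 : R)) cvg_sqr_p).
near=> x; have x0 : 0 < x by near: x; exact: nbhs_pinfty_gt.
apply/andP; split; first by rewrite mulr_ge0// ltW.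
by apply: ler_wpM2r => //; have := sqr_ge0 (x - 1); nra.
Unshelve. all: by end_near. Qed.

Lemma ge0_FTC0y (f F : R -> R) (l : R) : (forall x, 0 <= x -> 0 <= f x) ->
  continuous f -> (forall x : R, is_derive x 1 F (f x)) ->
  F x @[x --> +oo] --> l ->
  (\int[mu]_(x in `[0%R, +oo[) (f x)%:E = (l - F 0)%:E)%E.
Proof.
move=> f0 cf dF Fl; have cF : continuous F.
  by move=> x; apply/differentiable_continuous/derivable1_diffP/ex_derive.
rewrite EFinB; apply: ge0_continuous_FTC2y => //.
- by apply: continuous_subspaceT => x; exact: cf.
- exact/cvg_at_right_filter/cF.
- by move=> x _; rewrite derive1E derive_val.
Qed.

Let half_line : [set x : R | 0 <= x] = `[0, +oo[%classic.
Proof. by apply/seteqP; split=> x /=; rewrite in_itv/= andbT. Qed.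

Let half_p : (\int[mu]_(x in `[0%R, +oo[) (p x)%:E = 2^-1%:E)%E.
Proof.
have := integral_normal_pdf (0 : R) 1.
rewrite (ge0_symfun_integralT p_ge0 p_cont) => [|x]; last by rewrite /= p_even.
rewrite half_line; set I := (\int[_]_(_ in _) _)%E => h.
have : I \is a fin_num.
  have I0 : (0 <= I)%E by apply: integral_ge0 => x _; rewrite lee_fin.
  rewrite ge0_fin_numE// ltey; apply/eqP => Iy; move: h; rewrite Iy.
  by rewrite mulry gtr0_sg// mul1e.
move=> /fineK If; rewrite -/I -If in h *; congr EFin.
move: h => [h]; apply: (@mulfI _ 2) => //; rewrite mulfV// -h.
Qed.

(** The peak is [1 / sqrt (2 pi)], and [pi >= 2] suffices. This gives the bound 2 on the absolute
    third moment [4 / sqrt (2 pi)]. *)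
Let peak_le : normal_peak (1 : R) <= 2^-1.
Proof.
rewrite /normal_peak expr1n mul1r lef_pV2 ?posrE ?sqrtr_gt0//; last first.
  by rewrite mulrn_wgt0// pi_gt0.
rewrite -[leLHS](@ger0_norm _ 2)// -sqrtr_sqr ler_wsqrtr//.
by rewrite -mulr_natr; have := pi_ge2 R; lra.
Qed.

Let poly_p_cont (q : R -> R) : continuous q -> continuous (fun x => q x * p x).
Proof. by move=> cq x; apply: continuousM; [exact: cq|exact: p_cont]. Qed.

Let Xn_cont n : continuous (fun x : R => x ^+ n).
Proof. exact: exprn_continuous. Qed.

Let half_third :
  (\int[mu]_(x in `[0%R, +oo[) (x ^+ 3 * p x)%:E = (2 * normal_peak 1)%:E)%E.
Proof.
have dF (x : R) : is_derive x 1 (fun y => - ((y ^+ 2 + 2) * p y)) (x ^+ 3 * p x).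
  have h1 : is_derive x 1 (fun y : R => y ^+ 2 + 2) (2 * x).
    have h := is_deriveD (is_deriveX 2 (is_derive_id x (1 : R)))
      (is_derive_cst (2 : R) x (1 : R)).
    by apply: (is_derive_eq h); rewrite /GRing.scale /=; ring.
  have h : is_derive x 1 (fun y => - ((y ^+ 2 + 2) * p y)) _ :=
    is_deriveN (is_deriveM h1 (is_derive_p x)).
  by apply: (is_derive_eq h); rewrite /GRing.scale /=; ring.
have f0 (x : R) : 0 <= x -> 0 <= x ^+ 3 * p x.
  by move=> x0; rewrite mulr_ge0// exprn_ge0.
have cF : - ((x ^+ 2 + 2) * p x) @[x --> +oo] --> (0 : R).
  by rewrite -[X in _ --> X]oppr0; exact: cvgN.
rewrite (ge0_FTC0y f0 (poly_p_cont (@Xn_cont 3)) dF cF); congr EFin.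
by rewrite pE expr0n /= mul0r oppr0 expR0; ring.
Qed.

Let inv_cont : continuous (fun x : R => (1 + x ^+ 2)^-1).
Proof.
move=> x; apply: cvgV; first by rewrite gt_eqF// ltr_pwDl// sqr_ge0.
by apply: cvgD; [exact: cvg_cst|exact: Xn_cont].
Qed.

Let inv_ge0 (x : R) : 0 <= (1 + x ^+ 2)^-1.
Proof. by rewrite invr_ge0 addr_ge0// sqr_ge0. Qed.

Let half_inv :
  (\int[mu]_(x in `[0%R, +oo[) ((1 + x ^+ 2)^-1)%:E = (pi / 2)%:E)%E.
Proof.
rewrite (ge0_FTC0y (fun x _ => inv_ge0 x) inv_cont (@is_derive1_atan R)
  (@cvgy_atan R)).
by rewrite atan0 subr0.
Qed.

(* The summand (1 + x^2)^-1, of known integral, makes the derivative of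
   atan x - x p(x) nonnegative, as the improper fundamental theorem requires. *)
Let diff_ge0 x : 0 <= x ^+ 2 * p x - p x + (1 + x ^+ 2)^-1.
Proof.
have e : 0 < 1 + x ^+ 2 by rewrite ltr_pwDl// sqr_ge0.
rewrite addrC -lerBlDr sub0r opprB -div1r ler_pdivlMr//.
have p1 : p x <= 1.
  by have := normal_pdf_ub 0 x (oner_neq0 R); have := peak_le; rewrite /p; lra.
(* After multiplication by [1 + x^2] the claim reads [(1 - x^4) p x <= 1]. *)
have : 0 <= p x * x ^+ 2 ^+ 2 by rewrite mulr_ge0// sqr_ge0.
by move: (x ^+ 2) (p x) p1 => y q ? ?; nra.
Qed.

Let diff_cont : continuous (fun x : R => x ^+ 2 * p x - p x + (1 + x ^+ 2)^-1).
Proof.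
move=> x; apply: (@cvgD _ R^o); last exact: inv_cont.
apply: (@cvgB _ R^o); last exact: p_cont.
exact: (poly_p_cont (@Xn_cont 2)).
Qed.

Let half_diff : (\int[mu]_(x in `[0%R, +oo[)
  (x ^+ 2 * p x - p x + (1 + x ^+ 2)^-1)%:E = (pi / 2)%:E)%E.
Proof.
have dF (x : R) : is_derive x 1 (fun y => - (y * p y) + atan y)
    (x ^+ 2 * p x - p x + (1 + x ^+ 2)^-1).
  have h : is_derive x 1 (fun y => - (y * p y) + atan y) _ :=
    is_deriveD (is_deriveN (is_deriveM (is_derive_id x (1 : R)) (is_derive_p x)))
      (is_derive1_atan x).
  by apply: (is_derive_eq h); rewrite /GRing.scale /=; ring.
have cF : - (x * p x) + atan x @[x --> +oo] --> (pi / 2 : R).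
  rewrite -[X in _ --> X]add0r -[X in _ --> X + _]oppr0.
  by apply: cvgD; [exact: cvgN|exact: cvgy_atan].
rewrite (ge0_FTC0y (fun x _ => diff_ge0 x) diff_cont dF cF).
by rewrite mul0r oppr0 add0r atan0 subr0.
Qed.

Let measurable_half (f : R -> R) : continuous f ->
  measurable_fun (`[0%R, +oo[ : set (measurableTypeR R)) (fun x => (f x)%:E).
Proof.
move=> cf; apply/measurable_EFinP/measurable_funTS.
exact: continuous_measurable_fun.
Qed.

Let half_second : (\int[mu]_(x in `[0%R, +oo[) (x ^+ 2 * p x)%:E = 2^-1%:E)%E.
Proof.
have sqr_cont := poly_p_cont (@Xn_cont 2).
(* Adding [p] back isolates [x^2 p]: all summands are nonnegative, the other three integrals are
   known, and the finite term [pi / 2] cancels. *)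
have : (\int[mu]_(x in `[0%R, +oo[) ((x ^+ 2 * p x)%:E + ((1 + x ^+ 2)^-1)%:E) =
    \int[mu]_(x in `[0%R, +oo[)
      ((x ^+ 2 * p x - p x + (1 + x ^+ 2)^-1)%:E + (p x)%:E))%E.
  by apply: eq_integral => x _; rewrite -!EFinD; congr EFin; ring.
rewrite ge0_integralD//; last 4 first.
- by move=> x _; rewrite lee_fin mulr_ge0// sqr_ge0.
- exact: measurable_half.
- by move=> x _; rewrite lee_fin.
- exact: measurable_half.
rewrite ge0_integralD//; last 4 first.
- by move=> x _; rewrite lee_fin.
- exact: measurable_half.
- by move=> x _; rewrite lee_fin.
- exact: measurable_half.
rewrite half_inv half_diff half_p [RHS]addeC.
move=> /(congr1 (fun x => x - (pi / 2)%:E)%E).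
by rewrite !addeK.
Qed.

(** Change of variables gives the Radon-Nikodym derivative of [gamma]; it agrees almost everywhere
    with [p], both integrating to [gamma A] over every measurable [A]. *)
Let gamma_density (f : R -> R) : measurable_fun setT f -> (forall x, 0 <= f x) ->
  (\int[gamma]_x (f x)%:E = \int[mu]_x (f x * p x)%:E)%E.
Proof.
move=> mf f0; have dom := normal_prob_dominates (0 : R) 1.
have mf' : measurable_fun setT (fun x : measurableTypeR R => (f x)%:E).
  exact/measurable_EFinP.
rewrite -(Radon_Nikodym_SigmaFinite.change_of_variables dom _ measurableT mf');
  last first.
  by move=> x; rewrite lee_fin.
apply: ae_eq_integral => //.
- apply: emeasurable_funM => //.
  exact: measurable_int (Radon_Nikodym_SigmaFinite.f_integrable dom).
- by apply/measurable_EFinP/measurable_funM.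
- under [X in ae_eq _ _ _ X]eq_fun do rewrite EFinM.
  apply: ae_eqe_mul2l; apply: integral_ae_eq => //.
  + exact: Radon_Nikodym_SigmaFinite.f_integrable.
  + exact/measurable_EFinP.
  + move=> A _ mA; rewrite -(Radon_Nikodym_SigmaFinite.f_integral dom mA) //.
Qed.

Let even_moment (q : R -> R) : continuous q -> (forall x, 0 <= q x) ->
  (forall x, q (- x) = q x) ->
  (\int[gamma]_x (q x)%:E = 2 * \int[mu]_(x in `[0%R, +oo[) (q x * p x)%:E)%E.
Proof.
move=> cq q0 qe; rewrite gamma_density//; last exact: continuous_measurable_fun.
rewrite (@ge0_symfun_integralT _ (fun x => q x * p x)).
- by rewrite half_line.
- by move=> x; rewrite mulr_ge0.
- exact: poly_p_cont.
- by move=> x /=; rewrite qe p_even.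
Qed.

Lemma gaussian_second_moment : integral gamma setT (fun x : R => (x ^+ 2)%:E) = 1%:E.
Proof.
rewrite even_moment; [|exact: Xn_cont|exact: sqr_ge0|exact: sqrrN].
by rewrite half_second -EFinM mulfV.
Qed.

Lemma gaussian_third_moment :
  integral gamma setT (fun x : R => (`|x| ^+ 3)%:E) = (4 * normal_peak 1)%:E.
Proof.
have E : (\int[mu]_(x in `[0%R, +oo[) (`|x| ^+ 3 * p x)%:E =
    (2 * normal_peak 1)%:E)%E.
  rewrite -half_third; apply: eq_integral => x.
  by rewrite inE/= in_itv/= andbT => x0; rewrite ger0_norm.
rewrite (even_moment (q := fun x => `|x| ^+ 3)).
- by rewrite E -EFinM; congr EFin; ring.
- move=> x; apply: (@continuous_comp _ _ _ (Num.norm : R -> R)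
    (fun x : R => x ^+ 3)).
    exact: norm_continuous.
  exact: Xn_cont.
- by move=> x; rewrite exprn_ge0.
- by move=> x; rewrite normrN.
Qed.

Lemma gaussian_cube_inL1 : inL1 gamma (fun x : R => `|x| ^+ 3).
Proof.
apply/integrableP; split.
  by apply/measurable_EFinP/measurable_funX; exact: normr_measurable.
under eq_integral do rewrite gee0_abs ?lee_fin ?exprn_ge0//.
by rewrite gaussian_third_moment ltry.
Qed.

Lemma gaussian_third_moment_le2 : Rintegral gamma setT (fun x : R => `|x| ^+ 3) <= 2.
Proof. by rewrite /Rintegral gaussian_third_moment /=; have := peak_le; lra. Qed.

Lemma gaussian_symmetric (A : set (measurableTypeR R)) : measurable A ->
  gamma (-%R @^-1` A) = gamma A.
Proof.
move=> mA.
have mo : measurable_fun setT (-%R : measurableTypeR R -> measurableTypeR R).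
  exact: oppr_measurable.
have mp : measurable_fun A (fun x : measurableTypeR R => (p x)%:E).
  exact/measurable_funTS/measurable_EFinP.
have h := ge0_integral_pushforward mo mu mA mp (fun x _ => p_ge0 x).
transitivity (\int[mu]_(x in -%R @^-1` A) ((fun y : R => (p y)%:E) \o -%R) x)%E.
  by apply: eq_integral => x _ /=; rewrite p_even.
apply: (etrans (esym h)).
by apply: eq_measure_integral => B mB _; exact: lebesgue_measureN.
Qed.

(** By symmetry the mean equals its opposite; integrability, from the third moment, lets the sign
    come out of the integral. *)
Lemma gaussian_mean : Rintegral gamma setT (fun x : R => x) = 0.
Proof.
have mo : measurable_fun setT (-%R : measurableTypeR R -> measurableTypeR R).
  exact: oppr_measurable.
have mE : measurable_fun setT (fun x : measurableTypeR R => (x : R)%:E).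
  exact/measurable_EFinP.
have h := eq_law_integral (phi2 := id) mo (@measurable_id _ _ setT) mE gaussian_symmetric.
have [j1 _] := inL1_of_cube (P := gamma) (@measurable_id _ _ setT)
  gaussian_cube_inL1.
have : \int[gamma]_x (-1 * x) = \int[gamma]_x x.
  by rewrite /Rintegral; under eq_integral do rewrite mulN1r; rewrite h.
by rewrite RintZl//; move: (Rintegral _ _ _) => I; lra.
Qed.

End gaussian_moments.

(** * Universality *)

Section summable_moments.
Variables (R : realType) (d : measure_display) (T : measurableType d).
Variables (P : probability T R) (u : nat -> T -> R) (C : R).
Hypothesis u_ge0 : forall n w, 0 <= u n w.
Hypothesis ju : forall n, inL1 P (u n).
Hypothesis uC : forall n, \sum_(k < n) \int[P]_w u k w <= C.

(** The series of the [u n] has finite expectation by monotone convergence, hence is finite almost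
    everywhere, and the terms of a convergent series tend to 0. *)
Lemma ae_cvg0_summable : {ae P, forall w, u^~ w @ \oo --> (0 : R)}.
Proof.
have mu n : measurable_fun setT (fun w => (u n w)%:E).
  exact: measurable_int (ju n).
pose S w := (\sum_(0 <= n <oo) (u n w)%:E)%E.
have S_ge0 w : (0 <= S w)%E by apply: nneseries_ge0 => n _ _; rewrite lee_fin.
have mS : measurable_fun setT S.
  by apply: ge0_emeasurable_sum => // n w _ _; rewrite lee_fin.
have jS : P.-integrable setT S.
  apply/integrableP; split => //.
  under eq_integral do rewrite gee0_abs//.
  rewrite /S integral_nneseries//; last by move=> n w _; rewrite lee_fin.
  apply: (@le_lt_trans _ _ C%:E); last exact: ltry.
  apply: lime_le.
    apply: is_cvg_nneseries => n _ _; apply: integral_ge0 => w _.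
    by rewrite lee_fin.
  apply: nearW => n; rewrite big_mkord.
  under eq_bigr do rewrite -EFin_Rint//.
  by rewrite sumEFin lee_fin.
have := integrable_ae measurableT jS; apply: filterS => w /(_ I) Sw.
apply: cvg_series_cvg_0; apply: nnseries_is_cvg => //.
by rewrite -ge0_fin_numE; [exact: Sw|exact: S_ge0].
Qed.

End summable_moments.

Section three_halves.
Variable R : realType.

Lemma sum_inv_three_halves (n : nat) :
  \sum_(k < n) (k.+1%:R * Num.sqrt k.+1%:R)^-1 <= 3 :> R.
Proof.
case: n => [|n]; first by rewrite big_ord0.
(* The sharper bound is inductive: with [s], [t] the roots of [n + 1] and [n + 2], one has
   [1 / t^3 <= 2 / s - 2 / t]. It starts from the equality [1 = 3 - 2]. *)
suff h : \sum_(k < n.+1) (k.+1%:R * Num.sqrt k.+1%:R)^-1 <=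
    3 - 2 / Num.sqrt n.+1%:R :> R.
  by apply: (le_trans h); rewrite gerBl divr_ge0.
elim: n => [|n IH].
  rewrite big_ord_recr big_ord0 /= sqrtr1 mulr1 invr1; lra.
rewrite big_ord_recr /=; apply: (le_trans (lerD IH (lexx _))).
set s := Num.sqrt n.+1%:R : R; set t := Num.sqrt n.+2%:R : R.
have s0 : 0 < s by rewrite sqrtr_gt0.
have t0 : 0 < t by rewrite sqrtr_gt0.
have s2 : s ^+ 2 = n.+1%:R by rewrite sqr_sqrtr.
have t2 : t ^+ 2 = n.+2%:R by rewrite sqr_sqrtr.
have ts : t ^+ 2 = s ^+ 2 + 1 by rewrite s2 t2 -natr1.
have st : s <= t by rewrite ler_wsqrtr// ler_nat.
rewrite -t2 -lerBrDl.
rewrite (_ : _ - _ = 2 * (t ^+ 2 - s ^+ 2) / (s * t * (t + s))); last first.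
  by field; rewrite !gt_eqF//= addr_gt0.
rewrite (_ : t ^+ 2 - s ^+ 2 = 1); last by rewrite ts; ring.
rewrite mulr1 -[leLHS]div1r ler_pdivrMr ?mulr_gt0 ?exprn_gt0//.
rewrite mulrAC ler_pdivlMr ?mulr_gt0 ?addr_gt0// mul1r.
have h : s * (t + s) <= 2 * t ^+ 2 by nra.
have := ler_wpM2r (ltW t0) h; rewrite [s * t]mulrC; nra.
Qed.

End three_halves.

Section iid_environment.
Variables (R : realType) (d : measure_display) (T : measurableType d).
Variables (P : probability T R) (xi : nat -> nat -> {RV P >-> R}).
Variables (law : set R -> \bar R) (N : nat).
Hypothesis xi_iid : iid_env xi law.

Lemma iid_env_independent :
  independent P (fun (k : 'I_N * 'I_N) (w : T) => xi k.1 k.2 w).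
Proof.
have [ind _] := xi_iid; split; first by move=> k.
move=> B mB.
pose f (k : 'I_N * 'I_N) : nat * nat := (val k.1, val k.2).
have fI : injective f by move=> [i j] [i' j'] [/val_inj -> /val_inj ->].
(* Independence of the infinite array quantifies over sets indexed by all pairs of integers, so the
   given sides are extended by the whole line. *)
pose B' (p : nat * nat) : set R :=
  if (insub p.1, insub p.2) is (Some i, Some j) then B (i, j) else setT.
have B'f k : B' (f k) = B k by rewrite /B' /f !valK; case: k.
have mB' p : measurable (B' p).
  by rewrite /B'; case: insub => [i|]//; case: insub => [j|].
have := ind (map f (enum {: 'I_N * 'I_N})) B' _ mB'.
rewrite map_inj_uniq ?enum_uniq// => /(_ isT).
rewrite big_map big_enum /= => h.
transitivity (P (\bigcap_(i in [set` [seq f i | i <- enum {: 'I_N * 'I_N}]])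
    (xi i.1 i.2 @^-1` B' i))).
  congr (P _); apply/seteqP; split=> w /=.
    by move=> Bw _ /= /mapP[k _ ->]; rewrite /preimage /= B'f; exact: Bw.
  move=> Bw k; have := Bw (f k); rewrite /preimage /= B'f; apply.
  by rewrite map_f// mem_enum.
by rewrite h; apply: eq_bigr => k _; rewrite B'f.
Qed.

End iid_environment.

Section free_energy_regularity.
Variables (R : realType) (beta h : R) (N : nat).
Hypothesis beta_ge0 : 0 <= beta.

Let b_ge0 : 0 <= beta / Num.sqrt N%:R.
Proof. by rewrite divr_ge0// sqrtr_ge0. Qed.

Let s0 : {ffun 'I_N -> bool} := [ffun=> false].

Lemma measurable_free_energy : measurable_fun setT (@free_energy R beta h N).
Proof. exact: measurable_log_sum_exp. Qed.

Lemma free_energy_lipschitz (y z : 'I_N * 'I_N -> R) :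
  `|@free_energy R beta h N y - @free_energy R beta h N z|
    <= beta / Num.sqrt N%:R * \sum_k `|y k - z k|.
Proof.
by apply: (log_sum_exp_lipschitz s0) => //;
  [exact: spin_weight_gt0|exact: spin_product_sign].
Qed.

Lemma free_energy_expansion (y : 'I_N * 'I_N -> R) k : exists c0 c1 c2, forall v,
  `|@free_energy R beta h N (upd y k v) - (c0 + c1 * v + c2 * v ^+ 2)|
    <= 2 * (beta / Num.sqrt N%:R) ^+ 3 * `|v| ^+ 3.
Proof.
by apply: (log_sum_exp_expansion s0) => //;
  [exact: spin_weight_gt0|exact: spin_product_sign].
Qed.

End free_energy_regularity.

Lemma cvg0_cube (R : realType) (x : nat -> R) :
  (`|x n| ^+ 3) @[n --> \oo] --> (0 : R) -> x n @[n --> \oo] --> (0 : R).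
Proof.
move=> x3; apply/cvgr0Pnorm_lt => e e0.
have e3 : 0 < e ^+ 3 by rewrite exprn_gt0.
have /cvgr0Pnorm_lt /(_ _ e3) := x3; apply: filterS => n.
by rewrite normrX normr_id ltr_pXn2r ?nnegrE// ltW.
Qed.

Section universality.
Variables (R : realType) (d0 : measure_display) (T0 : measurableType d0).
Variables (P0 : probability T0 R) (X : {RV P0 >-> R}).
Variables (d : measure_display) (T : measurableType d) (P : probability T R).
Variable xi : nat -> nat -> {RV P >-> R}.
Variables (dg : measure_display) (Tg : measurableType dg) (Pg : probability Tg R).
Variable g : nat -> nat -> {RV Pg >-> R}.
Variables (beta h : R).
Hypothesis X_mean : \int[P0]_w X w = 0.
Hypothesis X_second : \int[P0]_w (X w ^+ 2) = 1.
Hypothesis X_third : inL1 P0 (fun w => `|X w| ^+ 3).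
Hypothesis xi_iid : iid_env xi (distribution P0 X).
Hypothesis g_iid : iid_env g (normal_prob (0 : R) 1).
Hypothesis beta_gt0 : 0 < beta.

Let mX := \int[P0]_w (`|X w| ^+ 3).
Let gamma : probability (measurableTypeR R) R := normal_prob (0 : R) 1.
Let F N := @free_energy R beta h N.
Let b N : R := beta / Num.sqrt N%:R.

(** Instead of comparing L2 and L3 norms, [t^2 <= 1/3 + 2/3 t^3] is integrated; it is an equality at
    [t = 1], so the second moment 1 yields exactly 1. *)
Let mX_ge1 : 1 <= mX.
Proof.
have mXf : measurable_fun setT X by [].
have [_ j2] := inL1_of_cube mXf X_third.
have j := inL1D (inL1_cst P0 3^-1) (inL1Zl (2 / 3) X_third).
have : \int[P0]_w (X w ^+ 2) <= \int[P0]_w (3^-1 + 2 / 3 * `|X w| ^+ 3).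
  apply: le_Rint => // w; rewrite -real_normK ?num_real//.
  have t0 : 0 <= `|X w| by []; move: (`|X w|) t0 => t t0.
  rewrite -subr_ge0 (_ : _ - _ = (t - 1) ^+ 2 * (2 * t + 1) / 3); last by field.
  by rewrite divr_ge0// mulr_ge0 ?sqr_ge0// addr_ge0// mulr_ge0.
rewrite X_second RintD; [|exact: inL1_cst|exact: inL1Zl].
rewrite Rint_cst RintZl// -/mX; lra.
Qed.

Let xi_marginal N k :
  eq_marginals P P0 (fun w => xi (k : 'I_N * 'I_N).1 k.2 w) X.
Proof. by move=> B mB; have [_ H] := xi_iid; exact: H. Qed.

Let g_marginal N k : eq_marginals Pg gamma
  (fun w => g (k : 'I_N * 'I_N).1 k.2 w) (id : measurableTypeR R -> R).
Proof. by move=> B mB; have [_ H] := g_iid; rewrite preimage_id; exact: H. Qed.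

Let cube_meas : measurable_fun setT (fun x : R => `|x| ^+ 3).
Proof. by apply: measurable_funX. Qed.

Let xi_third N k : inL1 P (fun w => `|xi (k : 'I_N * 'I_N).1 k.2 w| ^+ 3).
Proof.
by apply: (eq_marginals_inL1 (f := fun x : R => `|x| ^+ 3) _ _ _
  (@xi_marginal N k)).
Qed.

Let xi_third_mean N k :
  \int[P]_w (`|xi (k : 'I_N * 'I_N).1 k.2 w| ^+ 3) <= mX.
Proof.
rewrite le_eqVlt; apply/orP; left; apply/eqP.
by apply: (eq_marginals_Rint (f := fun x : R => `|x| ^+ 3) _ _ _
  (@xi_marginal N k)).
Qed.

Let g_third N k : inL1 Pg (fun w => `|g (k : 'I_N * 'I_N).1 k.2 w| ^+ 3).
Proof.
apply: (eq_marginals_inL1 (f := fun x : R => `|x| ^+ 3) _ _ _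
  (@g_marginal N k)) => //.
exact: gaussian_cube_inL1.
Qed.

Let log_xi N w : log_partition beta h xi N w =
  F (fun k : 'I_N * 'I_N => xi k.1 k.2 w).
Proof. exact: log_partitionE. Qed.

Let log_g N w : log_partition beta h g N w =
  F (fun k : 'I_N * 'I_N => g k.1 k.2 w).
Proof. exact: log_partitionE. Qed.

Let log_xi_inL1 N : inL1 P (log_partition beta h xi N).
Proof.
have mY (k : 'I_N * 'I_N) : measurable_fun setT (fun w => xi k.1 k.2 w) by [].
have jY (k : 'I_N * 'I_N) : inL1 P (fun w => xi k.1 k.2 w).
  by have [] := inL1_of_cube (mY k) (xi_third k).
rewrite (funext (log_xi N)).
exact: (lipschitz_inL1 (@measurable_free_energy R beta h N)
  (free_energy_lipschitz h (ltW beta_gt0)) mY jY).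
Qed.

Let log_g_inL1 N : inL1 Pg (log_partition beta h g N).
Proof.
have mY (k : 'I_N * 'I_N) : measurable_fun setT (fun w => g k.1 k.2 w) by [].
have jY (k : 'I_N * 'I_N) : inL1 Pg (fun w => g k.1 k.2 w).
  by have [] := inL1_of_cube (mY k) (g_third k).
rewrite (funext (log_g N)).
exact: (lipschitz_inL1 (@measurable_free_energy R beta h N)
  (free_energy_lipschitz h (ltW beta_gt0)) mY jY).
Qed.

Let mean_xi N : R := N%:R^-1 * \int[P]_w log_partition beta h xi N w.
Let mean_g N : R := N%:R^-1 * \int[Pg]_w log_partition beta h g N w.

Lemma mean_free_energy_xi N : mean_free_energy beta h xi N = (mean_xi N)%:E.
Proof. by rewrite /mean_free_energy unlock -EFin_Rint. Qed.

Lemma mean_free_energy_g N : mean_free_energy beta h g N = (mean_g N)%:E.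
Proof. by rewrite /mean_free_energy unlock -EFin_Rint. Qed.

Lemma universality_gap N : (1 <= N)%N ->
  `|mean_xi N - mean_g N| <= 9 * mX * (beta ^+ 3 / Num.sqrt N%:R).
Proof.
move=> N1; have mid : measurable_fun setT (id : measurableTypeR R -> R) by [].
have e1 : \int[P0]_w X w = Rintegral gamma setT (fun x : R => x).
  by rewrite X_mean gaussian_mean.
have e2 : \int[P0]_w (X w ^+ 2) = Rintegral gamma setT (fun x : R => x ^+ 2).
  by rewrite X_second /Rintegral gaussian_second_moment.
have := lindeberg_replacement (@measurable_free_energy R beta h N)
  (free_energy_lipschitz h (ltW beta_gt0))
  (free_energy_expansion h (ltW beta_gt0)) (measurable_funPT X) mid X_third
  (gaussian_cube_inL1 R) e1 e2 (erefl #|[set: 'I_N * 'I_N]%SET|)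
  (iid_env_independent N xi_iid) (fun k _ => @xi_marginal N k) _
  (iid_env_independent N g_iid) (@g_marginal N).
have noS k : k \notin [set: 'I_N * 'I_N]%SET -> eq_marginals P gamma
  (fun w => xi k.1 k.2 w) (id : measurableTypeR R -> R) by rewrite inE.
move=> /(_ noS); rewrite cardsT card_prod card_ord natrM => H.
have N0 : 0 < N%:R :> R by rewrite ltr0n.
have sN0 : 0 < Num.sqrt N%:R :> R by rewrite sqrtr_gt0.
rewrite /mean_xi /mean_g -mulrBr normrM normfV (gtr0_norm N0) ler_pdivrMl// [leRHS]mulrC.
have -> : \int[P]_w log_partition beta h xi N w =
    \int[P]_w F (fun k : 'I_N * 'I_N => xi k.1 k.2 w).
  by apply: eq_Rintegral => w _; exact: log_xi.
have -> : \int[Pg]_w log_partition beta h g N w =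
    \int[Pg]_w F (fun k : 'I_N * 'I_N => g k.1 k.2 w).
  by apply: eq_Rintegral => w _; exact: log_g.
pose mG := Rintegral gamma setT (fun x : R => `|x| ^+ 3).
have G2 : mG <= 2 by exact: gaussian_third_moment_le2.
apply: (@le_trans _ _ (N%:R * N%:R * (2 * b N ^+ 3 * (mX + mG)))); first exact: H.
(* There are [N^2] couplings and [b^3 = beta^3 / N^(3/2)]; the last factor [N] is the normalisation
   of the free energy. *)
have -> : N%:R * N%:R * (2 * b N ^+ 3 * (mX + mG)) =
    2 * (mX + mG) * (beta ^+ 3 / Num.sqrt N%:R) * N%:R.
  rewrite /b; have := sqr_sqrtr (ltW N0); move: (Num.sqrt N%:R) sN0 => s s0 <-.
  by field; rewrite gt_eqF.
rewrite ler_wpM2r ?(ltW N0)// ler_wpM2r//.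
  by rewrite divr_ge0 ?exprn_ge0 ?(ltW beta_gt0) ?(ltW sN0).
(* [2 * (mX + mG) <= 6 * mX], which leaves room below 9. *)
by have := mX_ge1; lra.
Qed.

Let K : R := 8 * mX * (Num.sqrt 2 * beta) ^+ 3.

Let centered N w : R :=
  log_partition beta h xi N w - \int[P]_v log_partition beta h xi N v.

Let centered_third N : inL3 P (centered N).
Proof.
apply: inL3B; last exact: inL3_cst.
have jY (k : 'I_N * 'I_N) : inL3 P (fun w => xi k.1 k.2 w).
  by split => //; exact: xi_third.
rewrite (funext (log_xi N)).
exact: (lipschitz_inL3 (@measurable_free_energy R beta h N)
  (free_energy_lipschitz h (ltW beta_gt0)) jY).
Qed.

Lemma centered_third_moment N : (1 <= N)%N ->
  \int[P]_w (`|N%:R^-1 * centered N w| ^+ 3) <=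
  K * (N%:R * Num.sqrt N%:R)^-1.
Proof.
move=> N1; have N0 : 0 < N%:R :> R by rewrite ltr0n.
have s0 : 0 < Num.sqrt N%:R :> R by rewrite sqrtr_gt0.
have r0 : 0 < Num.sqrt 2 :> R by rewrite sqrtr_gt0.
have b0 : 0 < b N by exact: divr_gt0.
(* The scale required by the concentration bound for [N^2] entries; it equals
   [sqrt 2 * beta * sqrt N], so [L^3 / N^3] decays like [N^(-3/2)] and [K] collects the
   constants. *)
pose L := Num.sqrt 2 * N%:R * b N.
have L0 : 0 < L by rewrite /L mulr_gt0// mulr_gt0.
have LE : L ^+ 2 = 2 * #|{: 'I_N * 'I_N}|%:R * b N ^+ 2.
  by rewrite card_prod card_ord natrM /L !exprMn sqr_sqrtr//; ring.
have := third_moment_concentration (ltW b0) (@measurable_free_energy R beta h N)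
  (free_energy_lipschitz h (ltW beta_gt0)) (iid_env_independent N xi_iid)
  (@xi_third N) (@xi_third_mean N) L0 LE.
have -> : \int[P]_w F (fun k : 'I_N * 'I_N => xi k.1 k.2 w) =
    \int[P]_w log_partition beta h xi N w.
  by apply: eq_Rintegral => w _; rewrite log_xi.
move=> H; under eq_Rintegral do rewrite normrM exprMn normfV (gtr0_norm N0).
rewrite RintZl; last exact: (centered_third N).2.
have {}H : \int[P]_w (`|centered N w| ^+ 3) <= 8 * mX * L ^+ 3.
  apply: le_trans H; rewrite le_eqVlt; apply/orP; left; apply/eqP.
  by apply: eq_Rintegral => w _; rewrite /centered log_xi.
apply: (@le_trans _ _ (N%:R^-1 ^+ 3 * (8 * mX * L ^+ 3))).
  by rewrite ler_wpM2l// exprn_ge0// invr_ge0 ltW.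
rewrite le_eqVlt; apply/orP; left; apply/eqP; rewrite /K /L /b.
have := sqr_sqrtr (ltW N0); move: (Num.sqrt N%:R) s0 => s s0 <-.
by field; rewrite gt_eqF.
Qed.

Let K_ge0 : 0 <= K.
Proof.
apply: mulr_ge0; first by have := mX_ge1; lra.
by rewrite exprn_ge0// mulr_ge0 ?sqrtr_ge0// ltW.
Qed.

Lemma centered_ae_cvg0 : {ae P, forall w,
  (N.+1%:R^-1 * centered N.+1 w) @[N --> \oo] --> (0 : R)}.
Proof.
(* The index is shifted because the moment bound holds from [N = 1] on. *)
pose u N w : R := `|N.+1%:R^-1 * centered N.+1 w| ^+ 3.
have u0 N w : 0 <= u N w by rewrite exprn_ge0.
have ju N : inL1 P (u N) by exact: (inL3Z _ (centered_third N.+1)).2.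
have uK n : \sum_(N < n) \int[P]_w u N w <= K * 3.
  apply: (@le_trans _ _ (\sum_(N < n) K * (N.+1%:R * Num.sqrt N.+1%:R)^-1)).
    by apply: ler_sum => N _; exact: centered_third_moment.
  by rewrite -mulr_sumr ler_wpM2l// sum_inv_three_halves.
have := ae_cvg0_summable u0 ju uK; apply: filterS => w; exact: cvg0_cube.
Qed.

Let gap_cvg0 : mean_xi N.+1 - mean_g N.+1 @[N --> \oo] --> (0 : R).
Proof.
have inv_sqrt : (Num.sqrt N.+1%:R)^-1 @[N --> \oo] --> (0 : R).
  rewrite -[X in _ --> X](@sqrtr0 R).
  under eq_fun do rewrite -sqrtrV//.
  by apply: (continuous_cvg _ (@sqrt_continuous R 0)); exact: cvg_harmonic.
have bd : 9 * mX * beta ^+ 3 * (Num.sqrt N.+1%:R)^-1 @[N --> \oo] --> (0 : R).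
  by rewrite -[X in _ --> X](mulr0 (9 * mX * beta ^+ 3)); apply: cvgM;
    [exact: cvg_cst|exact: inv_sqrt].
apply/norm_cvg0P; apply: (squeeze_cvgr _ (cvg_cst (0 : R)) bd).
apply: nearW => N; rewrite normr_ge0/=.
by rewrite -mulrA; exact: universality_gap.
Qed.

Lemma mean_xi_cvg (alpha : R) : mean_g N @[N --> \oo] --> alpha ->
  mean_xi N @[N --> \oo] --> alpha.
Proof.
rewrite -(cvg_shiftS mean_g) -(cvg_shiftS mean_xi) => aGl.
have := cvgD gap_cvg0 aGl; rewrite add0r => lim A /lim H.
apply: filterS (H : \forall N \near \oo, A _) => N.
by rewrite /preimage /= -[X in A X -> _]/(mean_xi N.+1 - mean_g N.+1 + mean_g N.+1) subrK.
Qed.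

Lemma free_energy_limit_universality (alpha : R) :
  free_energy_limit beta h g alpha -> free_energy_limit beta h xi alpha.
Proof.
move=> [_ meanG].
have aGl : mean_g N @[N --> \oo] --> alpha.
  have <- : fine \o mean_free_energy beta h g = mean_g.
    by apply: funext => N /=; rewrite mean_free_energy_g.
  exact: fine_cvg meanG.
have aXl := mean_xi_cvg aGl; split; last first.
  rewrite (funext mean_free_energy_xi).
  by apply: cvg_EFin => //; exact: nearW.
have := centered_ae_cvg0; apply: filterS => w w0.
rewrite -cvg_shiftS; move: aXl; rewrite -(cvg_shiftS mean_xi) => aXl.
(* The free energy is its centred part, which tends to 0 at [w], plus its mean, which tends to
   [alpha]. *)
have := cvgD w0 aXl; rewrite add0r => lim A /lim H.
apply: filterS (H : \forall N \near \oo, A _) => N.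
rewrite /preimage /= -[X in A X -> _]/(N.+1%:R^-1 * centered N.+1 w + mean_xi N.+1).
by rewrite /mean_xi /centered -mulrDr subrK.
Qed.

End universality.

Theorem theorem1 (R : realType)
  (* the random variable X giving the common law of the environment xi *)
  (d0 : measure_display) (T0 : measurableType d0) (P0 : probability T0 R)
  (X : {RV P0 >-> R})
  (d : measure_display) (T : measurableType d) (P : probability T R)
  (xi : nat -> nat -> {RV P >-> R})
  (* the Gaussian environment g *)
  (dg : measure_display) (Tg : measurableType dg) (Pg : probability Tg R)
  (g : nat -> nat -> {RV Pg >-> R})
  (beta h alpha_infty : R)
  (X_mean : 'E_P0[X]%E = 0%:E)
  (X_second : 'E_P0[(fun w => X w ^+ 2)%R]%E = 1%:E)
  (X_third : ('E_P0[(fun w => `|X w| ^+ 3)%R] < +oo)%E)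
  (xi_iid : iid_env xi (distribution P0 X))
  (g_iid : iid_env g (normal_prob (0 : R) 1))
  (beta_gt0 : 0 < beta)
  (* alpha_infty is, by definition, the Guerra-Toninelli limit of the Gaussian
     model *)
  (alpha_inftyP : free_energy_limit beta h g alpha_infty) :
  free_energy_limit beta h xi alpha_infty /\
  forall N : nat, (1 <= N)%N ->
    (`| mean_free_energy beta h xi N - mean_free_energy beta h g N |
     <= 9%:R%:E * 'E_P0[(fun w => `|X w| ^+ 3)%R]
        * (beta ^+ 3 / Num.sqrt N%:R)%:E)%E.
Proof.
have j3 : inL1 P0 (fun w => `|X w| ^+ 3).
  apply/integrableP; split.
    by apply/measurable_EFinP/measurable_funX; exact: measurableT_comp.
  under eq_integral do rewrite gee0_abs ?lee_fin ?exprn_ge0//.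
  by move: X_third; rewrite unlock.
have m1 : \int[P0]_w X w = 0 by move: X_mean; rewrite unlock /Rintegral => ->.
have m2 : \int[P0]_w (X w ^+ 2) = 1.
  by move: X_second; rewrite unlock /Rintegral => ->.
split; first exact: (free_energy_limit_universality m1 m2 j3 xi_iid g_iid).
move=> N N1; rewrite (mean_free_energy_xi h j3 xi_iid beta_gt0).
rewrite (mean_free_energy_g h g_iid beta_gt0) unlock -EFin_Rint// -EFinB -!EFinM.
by rewrite lee_fin; exact: universality_gap.
Qed.
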